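(* Let $(M,g)$ be a Riemannian manifold such that each tangent space $T_uM$ is a Hilbert space with inner product $g|_u$. For each $u\in M$ and $j=1,\dots,d$ let $A^j|_u$ be a self-adjoint operator in $(T_uM,g|_u)$, and assume that $\rho(\boldsymbol A|_u)<+\infty$ for each $u \in M$. Let $\hat M$ be a closed submanifold of $M$ with embedding $i:\hat M\to M$, let $\hat g:=i^*g$, and let $p:M\to\hat M$ be a smooth map with $p\circ i=\mathrm{id}_{\hat M}$. If $$\hat g(p_*X,\hat Y)|_{\hat u}=g(X,i_*\hat Y)|_{i(\hat u)}$$ holds for each $\hat u\in\hat M$, $X\in\Gamma(TM)$ and $\hat Y\in\Gamma(T\hat M)$, then, with $\hat A^j:=p_*\circ A^j\circ i_*$, for each $\hat u\in\hat M$ $$\rho(\hat{\boldsymbol A}|_{\hat u})\le\rho(\boldsymbol A|_{i(\hat u)})<+\infty.$$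
   Context: For $\boldsymbol\sigma=(\sigma_1,\dots,\sigma_d)\in\mathbb S^{d-1}\subset\mathbb R^d$ put $\boldsymbol\sigma\cdot\boldsymbol A|_u:=\sum_j\sigma_jA^j|_u$, and let $\rho(\boldsymbol\sigma\cdot\boldsymbol A|_u)$ be its spectral radius as an operator in $T_uM$. The maximum propagation speed at $u$ is $\rho(\boldsymbol A|_u):=\sup_{\boldsymbol\sigma\in\mathbb S^{d-1}}\rho(\boldsymbol\sigma\cdot\boldsymbol A|_u)$. The quantity $\rho(\hat{\boldsymbol A}|_{\hat u})$ is defined in the same way from the operators $\hat A^j|_{\hat u}$ in $(T_{\hat u}\hat M,\hat g|_{\hat u})$. Here $i_*,p_*$ are the differentials of $i,p$, with $p_*$ applied at points $i(\hat u)$. By the paper's convention, $i_*T_{\hat u}\hat M$ is a closed subspace of $T_{i(\hat u)}M$. *)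

(* Defs.v *)
From HB Require Import structures.
From mathcomp Require Import all_boot all_order all_algebra.
From mathcomp Require Import complex.
From mathcomp Require Import all_classical all_reals all_analysis.

Set Implicit Arguments.
Unset Strict Implicit.
Unset Printing Implicit Defensive.

Import Order.TTheory GRing.Theory Num.Theory.
Import numFieldNormedType.Exports.
Local Open Scope classical_set_scope.
Local Open Scope ring_scope.

(* f is C^n on the open set U, in terms of iterated differentials
   df(x, h) = 'd f x h viewed as maps on U x V.  A single C^n may differ from
   the usual one (where x |-> 'd f x has to be C^n for the operator norm), but
   Cn n.+1 implies n-fold continuous Frechet differentiability, so "Cn n for
   all n" is the usual C^oo. *)
Fixpoint Cn (R : realType) (n : nat) : forall V W : normedModType R,
    set V -> (V -> W) -> Prop :=
  match n with
  | 0%N => fun V W U f => forall x, U x -> {for x, continuous f}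
  | m.+1 => fun V W U f =>
      (forall x, U x -> differentiable f x) /\
      @Cn R m (V * V)%type W (U `*` [set: V]) (fun z => 'd f (z.1 : V) z.2)
  end.

Definition smooth_on (R : realType) (V W : normedModType R) (U : set V)
    (f : V -> W) : Prop :=
  forall n, Cn n U f.

Section InnerProducts.
Context {R : realType} {H : lmodType R}.
Implicit Type g : H -> H -> R.

Definition inner_product g : Prop :=
  [/\ forall x y, g x y = g y x,
      forall a x y z, g (a *: x + y) z = a * g x z + g y z
    & forall x, x != 0 -> 0 < g x x].

Definition ip_norm g (x : H) : R := Num.sqrt (g x x).

Definition ip_complete g : Prop :=
  forall s : nat -> H,
    (forall e, 0 < e -> exists N, forall m n, (N <= m)%N -> (N <= n)%N ->
       ip_norm g (s m - s n) < e) ->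
    exists l, forall e, 0 < e -> exists N, forall n, (N <= n)%N ->
       ip_norm g (s n - l) < e.

Definition hilbert_space g : Prop := inner_product g /\ ip_complete g.

End InnerProducts.

(* A linear operator in H, possibly unbounded, i.e. with a domain that need not
   be all of H.  The values of op_fun outside op_dom are irrelevant. *)
Record operator (R : realType) (H : lmodType R) := Operator {
  op_dom : set H;
  op_fun :> H -> H;
  op_dom0 : op_dom 0;
  op_domP : forall a x y, op_dom x -> op_dom y -> op_dom (a *: x + y);
  op_linear : forall a x y, op_dom x -> op_dom y ->
    op_fun (a *: x + y) = a *: op_fun x + op_fun y
}.

Section OperatorConstructions.
Context {R : realType}.

(* The usual convention: the domain is that of all the summands, even those with
   s 0 j = 0. *)
Section Combination.
Variables (H : lmodType R) (d : nat) (s : 'rV[R]_d) (A : 'I_d -> operator H).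

Let dom : set H := [set x | forall j, op_dom (A j) x].
Let val (x : H) : H := \sum_(j < d) s 0 j *: A j x.

Fact op_comb_dom0 : dom 0.
Proof. by move=> j; exact: op_dom0. Qed.

Fact op_comb_domP a x y : dom x -> dom y -> dom (a *: x + y).
Proof. by move=> dx dy j; apply: op_domP. Qed.

Fact op_comb_linear a x y : dom x -> dom y ->
  val (a *: x + y) = a *: val x + val y.
Proof.
move=> dx dy; rewrite /val scaler_sumr -big_split; apply: eq_bigr => j _ /=.
by rewrite op_linear// scalerDr !scalerA mulrC.
Qed.

Definition op_comb : operator H :=
  Operator op_comb_dom0 op_comb_domP op_comb_linear.

End Combination.

Section Sandwich.
Variables (H K : lmodType R) (P : {linear H -> K}) (A : operator H).
Variable J : {linear K -> H}.

Let dom : set K := [set y | op_dom A (J y)].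
Let val (y : K) : K := P (A (J y)).

Fact op_sandwich_dom0 : dom 0.
Proof. by rewrite /dom /= linear0; exact: op_dom0. Qed.

Fact op_sandwich_domP a x y : dom x -> dom y -> dom (a *: x + y).
Proof. by rewrite /dom /= linearP => dx dy; apply: op_domP. Qed.

Fact op_sandwich_linear a x y : dom x -> dom y ->
  val (a *: x + y) = a *: val x + val y.
Proof. by move=> dx dy; rewrite /val linearP op_linear// linearP. Qed.

Definition op_sandwich : operator K :=
  Operator op_sandwich_dom0 op_sandwich_domP op_sandwich_linear.

End Sandwich.
End OperatorConstructions.

Section Spectrum.
Context {R : realType} {H : lmodType R} (g : H -> H -> R).

(* A is densely defined and equal to its adjoint: (x, y) is in the graph of A
   iff it is in the graph of the adjoint. *)
Definition self_adjoint (A : operator H) : Prop :=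
  (forall x e, 0 < e -> exists2 z, op_dom A z & ip_norm g (x - z) < e) /\
  (forall x y, (op_dom A x /\ A x = y) <->
               (forall z, op_dom A z -> g (A z) x = g z y)).

(* H is a real space, so the spectrum of A is that of its complexification:
   (x, y) : H * H stands for x + i y, with norm (|x|^2 + |y|^2)^(1/2). *)
Definition cplx_norm (z : H * H) : R := Num.sqrt (g z.1 z.1 + g z.2 z.2).

Definition cplx_dom (A : operator H) : set (H * H) :=
  [set z | op_dom A z.1 /\ op_dom A z.2].

(* The map z |-> (A - l) z of the complexification. *)
Definition cplx_shift (A : operator H) (l : R[i]) (z : H * H) : H * H :=
  let a := complex.Re l in
  let b := complex.Im l in
  (A z.1 - (a *: z.1 - b *: z.2), A z.2 - (a *: z.2 + b *: z.1)).

(* A - l is a bijection from its domain onto H + i H with bounded inverse. *)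
Definition resolvent_set (A : operator H) : set R[i] :=
  [set l | exists B : H * H -> H * H,
     [/\ forall z, cplx_dom A z -> B (cplx_shift A l z) = z,
         forall w, cplx_dom A (B w) /\ cplx_shift A l (B w) = w
       & exists C : R, forall w, cplx_norm (B w) <= C * cplx_norm w]].

Definition spectrum (A : operator H) : set R[i] := ~` resolvent_set A.

(* Adding 0 to the set only matters when the spectrum is empty, as for H = 0:
   the radius is then 0 rather than -oo. *)
Definition spectral_radius (A : operator H) : \bar R :=
  ereal_sup ([set 0%E] `|` [set (complex.Re `|l|)%:E | l in spectrum A]).

Definition sphere (d : nat) : set 'rV[R]_d :=
  [set s | \sum_(j < d) s 0 j ^+ 2 = 1].

Definition max_speed (d : nat) (A : 'I_d -> operator H) : \bar R :=
  ereal_sup [set spectral_radius (op_comb s A) | s in @sphere d].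

End Spectrum.

(* A homeomorphism from an open set of M onto an open set of E.  The maps are
   total functions, whose values outside chart_dom and chart_cod are
   irrelevant. *)
Record chart (R : realType) (E : normedModType R) (M : topologicalType) :=
  Chart {
  chart_dom : set M;
  chart_cod : set E;
  chart_map :> M -> E;
  chart_inv : E -> M;
  chart_dom_open : open chart_dom;
  chart_cod_open : open chart_cod;
  chart_map_cod : forall u, chart_dom u -> chart_cod (chart_map u);
  chart_inv_dom : forall x, chart_cod x -> chart_dom (chart_inv x);
  chart_mapK : forall u, chart_dom u -> chart_inv (chart_map u) = u;
  chart_invK : forall x, chart_cod x -> chart_map (chart_inv x) = x;
  chart_map_continuous :
    forall u, chart_dom u -> {for u, continuous chart_map};
  chart_inv_continuous :
    forall x, chart_cod x -> {for x, continuous chart_inv}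
}.

Definition compatible (R : realType) (E : normedModType R)
    (M : topologicalType) (c c' : chart E M) : Prop :=
  smooth_on (chart_cod c `&` (chart_inv c @^-1` chart_dom c'))
            (fun x => c' (chart_inv c x)).

(* The dimension of the model space E may be infinite.  Regularity follows from
   the other axioms when E has finite dimension, and also when the manifold
   carries a Riemannian metric with complete tangent spaces (the geodesic
   distance then metrizes the topology). *)
Record manifold (R : realType) (E : completeNormedModType R) := Manifold {
  carrier :> topologicalType;
  atlas : set (chart E carrier);
  manifold_hausdorff : hausdorff_space carrier;
  manifold_regular : regular_space carrier;
  model_hilbert : exists2 g : E -> E -> R,
    inner_product g & forall x, `|x| = ip_norm g x;
  atlas_cover : forall u, exists2 c, atlas c & chart_dom c u;
  atlas_compatible : forall c c', atlas c -> atlas c' -> compatible c c'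
}.

Section TangentSpaces.
Context {R : realType} {E : completeNormedModType R} {M : manifold E}.

(* A fixed chart of the atlas around u. *)
Definition chart_at (u : M) : chart E M := s2val (cid2 (atlas_cover u)).

(* A tangent vector at u is represented by its coordinates in chart_at u. *)
Definition tangent (u : M) : completeNormedModType R := E.

(* The coordinates in the chart c of the vector v tangent at u. *)
Definition to_chart (c : chart E M) (u : M) (v : tangent u) : E :=
  'd (fun x : E => c (chart_inv (chart_at u) x)) (chart_at u u) v.

(* The vector tangent at u with coordinates v in the chart c. *)
Definition of_chart (c : chart E M) (u : M) (v : E) : tangent u :=
  'd (fun x : E => chart_at u (chart_inv c x)) (c u) v.

Definition smooth_field (X : forall u : M, tangent u) : Prop :=
  forall c, atlas c ->
    smooth_on (chart_cod c)
      (fun x : E => to_chart c (X (chart_inv c x))).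

Definition metric := forall u : M, tangent u -> tangent u -> R.

(* Joint smoothness in the point and the two vectors is, by bilinearity, the
   same as smoothness of g as a map into the bounded bilinear forms. *)
Definition riemannian_metric (g : metric) : Prop :=
  (forall u, inner_product (@g u)) /\
  (forall c, atlas c ->
     smooth_on (chart_cod c `*` [set: E] `*` [set: E])
       (fun z : E * E * E =>
          let u := chart_inv c z.1.1 in
          g u (of_chart c u z.1.2) (of_chart c u z.2) : R^o)).

End TangentSpaces.

Arguments metric {R E} M.

Section SmoothMaps.
Context {R : realType} {E F : completeNormedModType R}.
Context {N : manifold F} {M : manifold E}.

Definition smooth_map (f : N -> M) : Prop :=
  continuous f /\
  (forall c c', atlas c -> atlas c' ->
     smooth_on
       (chart_cod c `&` ((fun x => f (chart_inv c x)) @^-1` chart_dom c'))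
       (fun x : F => c' (f (chart_inv c x)))).

Definition tangent_map (f : N -> M) (u : N) :
    {linear tangent u -> tangent (f u)} :=
  'd (fun x : F => chart_at (f u) (f (chart_inv (chart_at u) x)))
     (chart_at u u).

Definition pullback (f : N -> M) (g : metric M) : metric N :=
  fun u x y => g (f u) (tangent_map f u x) (tangent_map f u y).

(* Closed ranges in a Hilbert space are complemented, so the second and third
   clauses say that f is an immersion; the fourth one says that the topology
   of N is induced by f, and the last one that the image is closed. *)
Definition closed_embedding (f : N -> M) : Prop :=
  [/\ smooth_map f,
      forall u, injective (tangent_map f u),
      forall u, closed (range (tangent_map f u)),
      injective f /\
        (forall U : set N, open U -> exists2 V : set M, open V & U = f @^-1` V)
    & closed (range f)].

End SmoothMaps.

(* Main.v *)
(** The differentials satisfy [p_* i_* = id] by the chain rule.  Every tangent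
    vector extends to a smooth vector field (a bump function times the field
    that is constant in a chart), so the hypothesis on [p] says that [p_*] is
    the adjoint of [i_*].  What remains is a statement on a Hilbert space [H]
    and a compression [P A J] with [P = J^*] and [P J = 1].

    If all real [t] with [|t| > r] are in the resolvent set of a symmetric
    operator [B], then [|(B - t) x| >= (|t| - r) |x|] for these [t]; squaring
    and letting [t] tend to [+oo] and [-oo] gives [|<B x, x>| <= r |x|^2], and
    hence [|B x| <= r |x|] if [B] is densely defined.  Finite speed in a
    coordinate direction thus forces the [A^j] to be everywhere defined.  The
    bound on the quadratic form passes to [P B J], whose norm is therefore at
    most [r], and the Neumann series inverts [P B J - l] for [|l| > r]. *)
Require Import Defs.
From HB Require Import structures.
From mathcomp Require Import all_boot all_order all_algebra.
From mathcomp Require Import complex ring lra.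
From mathcomp Require Import all_classical all_reals all_analysis.

Set Implicit Arguments.
Unset Strict Implicit.
Unset Printing Implicit Defensive.

Import Order.TTheory GRing.Theory Num.Theory.
Import numFieldNormedType.Exports.
Local Open Scope classical_set_scope.
Local Open Scope ring_scope.

(** * Inner products *)

Section InnerProductTheory.
Context {R : realType} {H : lmodType R} {g : H -> H -> R}.
Hypothesis ipg : inner_product g.

Lemma ipC x y : g x y = g y x.
Proof. by case: ipg. Qed.

Lemma ipDl x y z : g (x + y) z = g x z + g y z.
Proof. by case: ipg => _ l _; rewrite -[x]scale1r l mul1r scale1r. Qed.

Lemma ip0l z : g 0 z = 0.
Proof.
have /eqP := ipDl 0 0 z.
by rewrite addr0 -subr_eq0 opprD addNKr oppr_eq0 => /eqP.
Qed.

Lemma ipZl a x z : g (a *: x) z = a * g x z.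
Proof. by case: ipg => _ l _; rewrite -[a *: x]addr0 l ip0l addr0. Qed.

Lemma ipNl x z : g (- x) z = - g x z.
Proof. by rewrite -scaleN1r ipZl mulN1r. Qed.

Lemma ipBl x y z : g (x - y) z = g x z - g y z.
Proof. by rewrite ipDl ipNl. Qed.

Lemma ipDr z x y : g z (x + y) = g z x + g z y.
Proof. by rewrite ipC ipDl !(ipC _ z). Qed.

Lemma ipZr a x z : g z (a *: x) = a * g z x.
Proof. by rewrite ipC ipZl ipC. Qed.

Lemma ipNr x z : g z (- x) = - g z x.
Proof. by rewrite ipC ipNl ipC. Qed.

Lemma ipBr z x y : g z (x - y) = g z x - g z y.
Proof. by rewrite ipDr ipNr. Qed.

Lemma ip0r z : g z 0 = 0.
Proof. by rewrite ipC ip0l. Qed.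

Definition ipE := (ipDl, ipDr, ipNl, ipNr, ipZl, ipZr, ip0l, ip0r).

Lemma ip_ge0 x : 0 <= g x x.
Proof.
case: (eqVneq x 0) => [->|x0]; first by rewrite ip0l.
by case: ipg => _ _ /(_ x x0)/ltW.
Qed.

Lemma ip_gt0 x : (0 < g x x) = (x != 0).
Proof.
by case: (eqVneq x 0) => [->|x0]; [rewrite ip0l ltxx | case: ipg => _ _ ->].
Qed.

(* Reduces identities between vectors to identities in R, for [ring]. *)
Lemma ip_ext x y : (forall z, g x z = g y z) -> x = y.
Proof.
move=> h; apply/subr0_eq/eqP; rewrite -[_ == _]negbK -ip_gt0.
by rewrite ipBl h subrr ltxx.
Qed.

(** The square of [g y y *: x - g x y *: y] is non-negative and equals [g y y] times the difference
    of the two sides. *)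
Lemma ip_cauchy_schwarz x y : g x y ^+ 2 <= g x x * g y y.
Proof.
case: (eqVneq y 0) => [->|y0]; first by rewrite !ip0r expr0n mulr0.
have gy : 0 < g y y by rewrite ip_gt0.
have := ip_ge0 (g y y *: x - g x y *: y).
rewrite !ipE (ipC y x) => h.
suff : 0 <= g y y * (g x x * g y y - g x y ^+ 2) by rewrite pmulr_rge0// subr_ge0.
by move: h; congr (0 <= _); ring.
Qed.

Lemma ip_norm_ge0 x : 0 <= ip_norm g x.
Proof. exact: sqrtr_ge0. Qed.

Lemma ip_norm_sqr x : ip_norm g x ^+ 2 = g x x.
Proof. by rewrite sqr_sqrtr// ip_ge0. Qed.

Lemma ip_norm_eq0 x : ip_norm g x = 0 -> x = 0.
Proof.
move=> h; apply/eqP; apply: contraT; rewrite -ip_gt0 -ip_norm_sqr h.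
by rewrite expr0n ltxx.
Qed.

Lemma ip_norm0 : ip_norm g 0 = 0.
Proof. by rewrite /ip_norm ip0l sqrtr0. Qed.

Lemma ip_normZ a x : ip_norm g (a *: x) = `|a| * ip_norm g x.
Proof.
by rewrite /ip_norm ipZl ipZr mulrA -expr2 sqrtrM ?sqr_ge0// sqrtr_sqr.
Qed.

Lemma ip_normN x : ip_norm g (- x) = ip_norm g x.
Proof. by rewrite -scaleN1r ip_normZ normrN1 mul1r. Qed.

Lemma ip_norm_sub x y : ip_norm g (x - y) = ip_norm g (y - x).
Proof. by rewrite -ip_normN opprB. Qed.

Lemma ip_abs_le x y : `|g x y| <= ip_norm g x * ip_norm g y.
Proof.
rewrite -(@ler_pXn2r _ 2)// ?nnegrE ?mulr_ge0 ?ip_norm_ge0//.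
by rewrite real_normK ?num_real// exprMn !ip_norm_sqr ip_cauchy_schwarz.
Qed.

Lemma ip_norm_le c x : 0 <= c -> g x x <= c ^+ 2 -> ip_norm g x <= c.
Proof.
by move=> c0 h; rewrite -(@ler_pXn2r _ 2)// ?nnegrE ?ip_norm_ge0// ip_norm_sqr.
Qed.

Lemma ip_norm_triangle x y : ip_norm g (x + y) <= ip_norm g x + ip_norm g y.
Proof.
apply: ip_norm_le; first by rewrite addr_ge0// ip_norm_ge0.
rewrite !ipE (ipC y x) sqrrD !ip_norm_sqr.
have := le_trans (ler_norm _) (ip_abs_le x y); lra.
Qed.

Lemma ip_norm_eq0_small x : (forall e, 0 < e -> ip_norm g x < e) -> x = 0.
Proof.
move=> h; apply: ip_norm_eq0; apply/eqP; rewrite eq_le ip_norm_ge0 andbT.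
by apply/ler_addgt0Pr => e e0; rewrite add0r ltW// h.
Qed.

Lemma ip_bilinear : bilinear_for
  (GRing.Scale.Law.clone _ _ *:%R _) (GRing.Scale.Law.clone _ _ *:%R _)
  (g : H -> H -> R^o).
Proof. by split=> [y|x] a u v /=; rewrite !ipE. Qed.

End InnerProductTheory.

(** * Calculus of the classes [Cn] *)

Section DifferentialLocality.
Context {R : realType} {V W : normedModType R}.
Implicit Types f h : V -> W.

(** [f] is its own remainder: being [o(y - x)] at [x], it has an expansion with value and
    differential zero. *)
Lemma is_diff_little f x : f x = 0 ->
  (forall e, 0 < e -> \forall y \near x, `|f y| <= e * `|y - x|) ->
  is_diff x f 0.
Proof.
move=> fx0 fle.
have d0 : f \o shift x = cst (f x) + 0 +o_ 0 id.
  apply/eqaddoE; rewrite fx0 addr0.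
  rewrite funeqE => y /=; rewrite /cst /= -[LHS]add0r; congr (_ + _).
  rewrite -[LHS]/((f \o shift x) y); congr (_ y).
  apply/eqoP => _/posnumP[e].
  have := fle _ [elaborate gt0 e]; rewrite (near_shift 0 x) /=.
  by apply: filterS => z /=; rewrite subr0 addrK.
have d : 'd f x = 0 :> (V -> W).
  rewrite (@diff_unique _ _ _ f (GRing.null_fun _)) //.
  exact: cst_continuous.
split=> //; apply/diff_locallyP; rewrite d; split=> //; exact: cst_continuous.
Qed.

Lemma is_diff_near0 f x : (\forall y \near x, f y = 0) -> is_diff x f 0.
Proof.
move=> f0; apply: is_diff_little => [|e e0]; first exact: nbhs_singleton f0.
by apply: filterS f0 => y ->; rewrite normr0 mulr_ge0// ltW.
Qed.

(** [h] is [f] plus a function that vanishes near [x] and so has differential zero there. *)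
Lemma near_eq_is_diff f h x : (\forall y \near x, f y = h y) ->
  differentiable f x -> is_diff x h ('d f x).
Proof.
move=> fh df.
have -> : h = f + (h - f) by apply/funext => y; rewrite !fctE addrC subrK.
have d0 : is_diff x (h - f) 0.
  by apply: is_diff_near0; apply: filterS fh => y e; rewrite !fctE e subrr.
have dfx := differentiableP df.
by apply: is_diff_eq; rewrite addr0.
Qed.

End DifferentialLocality.

Section CnCalculus.
Context {R : realType}.
Implicit Types U V W : normedModType R.

Lemma Cn_le n V W (A : set V) (f : V -> W) : Cn n.+1 A f -> Cn n A f.
Proof.
elim: n V W A f => [|n IH] V W A f.
  by move=> [d _] x /d; exact: differentiable_continuous.
by move=> [d c]; split=> //; apply: IH.
Qed.

(** [Cn] imposes its conditions point by point, with differentials taken in the ambient space, so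
    they can be read off on any [B] through the point. *)
Lemma Cn_local n V W (A : set V) (f : V -> W) :
  (forall x, A x -> exists2 B, B x & Cn n B f) -> Cn n A f.
Proof.
elim: n V W A f => [|n IH] V W A f H /=.
  by move=> x /H[B Bx]; exact.
split; first by move=> x /H[B Bx [d _]]; exact: d.
apply: IH => -[x h] [/= /H[B Bx [_ c]] _].
by exists (B `*` [set: V]).
Qed.

Lemma open_setXT V W (A : set V) : open A -> open (A `*` [set: W]).
Proof.
move=> oA; rewrite openE => -[x y] [/= Ax _].
exists (A, [set: W]) => /=; last by [].
by split; [exact: open_nbhs_nbhs | exact: filterT].
Qed.

(** On an open set, equal functions agree near each point and have equal differentials, which
    carries the induction on [n]. *)
Lemma Cn_eq n V W (A : set V) (f h : V -> W) : open A ->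
  (forall x, A x -> f x = h x) -> Cn n A f -> Cn n A h.
Proof.
elim: n V W A f h => [|n IH] V W A f h oA fh.
  move=> c x Ax; have := c x Ax; rewrite /prop_for /continuous_at -(fh x Ax).
  apply: cvg_trans; apply: near_eq_cvg; apply: filterS (open_nbhs_nbhs (conj oA Ax)) => y.
  exact: fh.
move=> [d c].
have dh x : A x -> is_diff x h ('d f x).
  move=> Ax; apply: near_eq_is_diff (d x Ax).
  apply: filterS (open_nbhs_nbhs (conj oA Ax)) => y; exact: fh.
split; first by move=> x /dh [].
apply: IH c; first exact: open_setXT.
by move=> [x y] [/= /dh[_ ->]].
Qed.

(** The differential at every point is [f] itself, so the map to treat at the next order is
    [f \o snd], again linear and continuous. *)
Lemma Cn_lin n V W (A : set V) (f : {linear V -> W}) :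
  continuous f -> Cn n A f.
Proof.
elim: n V W A f => [|n IH] V W A f fc; first by move=> x _; exact: fc.
split; first by move=> x _; exact: linear_differentiable.
have -> : (fun z : V * V => 'd f (z.1 : V) z.2) = (f \o snd).
  by apply/funext => z /=; rewrite diff_lin.
apply: IH => z; apply: continuous_comp; [exact: cvg_snd | exact: fc].
Qed.

Lemma Cn_cst n V W (A : set V) (a : W) : Cn n A (fun _ : V => a).
Proof.
elim: n V W A a => [|n IH] V W A a; first by move=> x _; exact: cvg_cst.
split; first by move=> x _; exact: differentiable_cst.
have -> : (fun z : V * V => 'd (fun=> a) (z.1 : V) z.2) = (fun=> 0); last exact: IH.
by apply/funext => z /=; rewrite diff_cst.
Qed.

Lemma Cn_fst n V W (A : set (V * W)) : Cn n A fst.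
Proof. apply: Cn_lin => z; exact: cvg_fst. Qed.

Lemma Cn_snd n V W (A : set (V * W)) : Cn n A snd.
Proof. apply: Cn_lin => z; exact: cvg_snd. Qed.

Lemma Cn_pair n U V W (A : set U) (f : U -> V) (h : U -> W) : open A ->
  Cn n A f -> Cn n A h -> Cn n A (fun x => (f x, h x)).
Proof.
elim: n U V W A f h => [|n IH] U V W A f h oA.
  by move=> cf ch x Ax; apply: cvg_pair; [exact: cf | exact: ch].
move=> [df cf] [dh ch]; split.
  by move=> x Ax; apply: differentiable_pair; [exact: df | exact: dh].
apply: Cn_eq (IH _ _ _ _ _ _ (open_setXT oA) cf ch); first exact: open_setXT.
by move=> [x y] [/= Ax _]; rewrite diff_pair //; [exact: df | exact: dh].
Qed.

(** By the chain rule, the differential of the composite at [(x, v)] is that of [h] at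
    [(f x, 'd f x v)]. The induction hypothesis serves for [f \o fst], and again for this pair
    followed by the differential of [h]. *)
Lemma Cn_comp n U V W (A : set U) (B : set V) (f : U -> V) (h : V -> W) :
  open A -> (forall x, A x -> B (f x)) ->
  Cn n A f -> Cn n B h -> Cn n A (fun x => h (f x)).
Proof.
elim: n U V W A B f h => [|n IH] U V W A B f h oA AB.
  move=> cf ch x Ax; apply: (@continuous_comp _ _ _ f h); first exact: cf.
  exact/ch/AB.
move=> cf1; have cf0 := Cn_le cf1; case: cf1 => df cf [dh ch]; split.
  by move=> x Ax; apply: (@differentiable_comp _ _ _ _ f h);
    [exact: df | exact/dh/AB].
have oA2 := open_setXT (W := U) oA.
have cp : Cn n (A `*` [set: U]) (fun z : U * U => (f z.1, 'd f (z.1 : U) z.2)).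
  apply: Cn_pair => //; apply: IH cf0 => //; last exact: Cn_fst.
  by move=> z [].
apply: Cn_eq (IH _ _ _ _ _ _ _ oA2 _ cp ch) => //; last by move=> z [/AB].
move=> [x y] [/= Ax _]; rewrite -[fun x => h (f x)]/(h \o f).
by rewrite (@diff_comp _ _ _ _ f h x) //; [exact: df|exact/dh/AB].
Qed.

Lemma Cn_add n V W (A : set V) (f h : V -> W) : open A ->
  Cn n A f -> Cn n A h -> Cn n A (fun x => f x + h x).
Proof.
move=> oA cf ch.
pose add2 (z : W * W) := z.1 + z.2.
have ladd : linear add2.
  by move=> a x y; rewrite /add2 /= scalerDr addrACA.
pose addM := GRing.isLinear.Build _ _ _ _ _ ladd.
pose addL : {linear _ -> _} := HB.pack add2 addM.
have c : Cn n [set: W * W] addL.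
  by apply: Cn_lin => z; exact: add_continuous.
exact: (Cn_comp oA _ (Cn_pair oA cf ch) c).
Qed.

(** The differential is a sum of two terms, each [B] applied to projections, so the induction
    hypothesis composed with projections gives the next order. *)
Lemma Cn_bilin_full n U V W (B : {bilinear U -> V -> W}) :
  continuous (fun q : U * V => B q.1 q.2) ->
  Cn n [set: U * V] (fun q : U * V => B q.1 q.2).
Proof.
move=> Bc; elim: n => [|n IH]; first by move=> x _; exact: Bc.
split; first by move=> x _; exact: differentiable_bilin.
have -> : (fun z : (U * V) * (U * V) =>
    'd (fun q : U * V => B q.1 q.2) (z.1 : (U * V)%type) z.2) =
  fun z : (U * V) * (U * V) => B z.1.1 z.2.2 + B z.2.1 z.1.2.
  by apply/funext => z; rewrite diff_bilin.
have oTT : open ([set: U * V] `*` [set: U * V]).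
  by apply: open_setXT; exact: openT.
have cB (f : (U * V) * (U * V) -> U) (h : (U * V) * (U * V) -> V) :
    Cn n ([set: U * V] `*` [set: U * V]) f ->
    Cn n ([set: U * V] `*` [set: U * V]) h ->
    Cn n ([set: U * V] `*` [set: U * V]) (fun z => B (f z) (h z)).
  by move=> cf ch; exact: (Cn_comp oTT _ (Cn_pair oTT cf ch) IH).
have c2 (T T' : normedModType R) (f : (U * V) * (U * V) -> T * T') :
    Cn n ([set: U * V] `*` [set: U * V]) f ->
    Cn n ([set: U * V] `*` [set: U * V]) (fun z => (f z).1) /\
    Cn n ([set: U * V] `*` [set: U * V]) (fun z => (f z).2).
  by move=> cf; split;
    [exact: (Cn_comp oTT (fun _ _ => I) cf (@Cn_fst n T T' setT))
    |exact: (Cn_comp oTT (fun _ _ => I) cf (@Cn_snd n T T' setT))].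
have [c11 c12] := c2 _ _ _ (@Cn_fst n _ _ _).
have [c21 c22] := c2 _ _ _ (@Cn_snd n _ _ _).
by apply: Cn_add => //; exact: cB.
Qed.

Lemma Cn_bilin n (T U V W : normedModType R) (B : {bilinear U -> V -> W})
    (A : set T) (f : T -> U) (h : T -> V) : open A ->
  continuous (fun q : U * V => B q.1 q.2) ->
  Cn n A f -> Cn n A h -> Cn n A (fun x => B (f x) (h x)).
Proof.
move=> oA Bc cf ch.
exact: (Cn_comp oA _ (Cn_pair oA cf ch) (Cn_bilin_full _ Bc)).
Qed.

Lemma Cn_scale n V W (A : set V) (f : V -> R) (h : V -> W) : open A ->
  Cn n A (f : V -> R^o) -> Cn n A h -> Cn n A (fun x => f x *: h x).
Proof.
have bil : bilinear_for
    (GRing.Scale.Law.clone _ _ *:%R _) (GRing.Scale.Law.clone _ _ *:%R _)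
    (fun (k : R^o) (w : W) => k *: w).
  split=> [w|k] a x y /=; first by rewrite scalerDl scalerA.
  by rewrite scalerDr !scalerA mulrC.
pose M := bilinear_isBilinear.Build R R^o W W _ _ _ bil.
pose B : {bilinear R^o -> W -> W} := HB.pack (fun (k : R^o) (w : W) => k *: w) M.
move=> oA cf ch; apply: (Cn_bilin (B := B)) => //.
exact: scale_continuous.
Qed.

End CnCalculus.

(** * A smooth function on the line that is flat at 0 *)

Section FlatFunction.
Context {R : realType}.

(* The powers of 1/t make the family closed under derivation, up to linear
   combinations, so that smoothness follows by induction for all k at once. *)
Definition flat (k : nat) (t : R) : R :=
  if 0 < t then t^-1 ^+ k * expR (- t^-1) else 0.

Lemma flat_neg k t : t <= 0 -> flat k t = 0.
Proof. by rewrite /flat leNgt => /negbTE ->. Qed.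

(** With [s = 1 / t], this is the estimate of one term of the exponential series,
    [s ^ (k + 2) / (k + 2)! <= exp s]. Being quadratic in [t], the bound yields differentiability at
    0. *)
Lemma flat_le k t : `|flat k t| <= k.+2`!%:R * `|t| ^+ 2.
Proof.
rewrite /flat; case: ifPn => [t0|_]; last first.
  by rewrite normr0 mulr_ge0// exprn_ge0.
have s0 : 0 < t^-1 by rewrite invr_gt0.
rewrite ger0_norm; last by rewrite mulr_ge0 ?expR_ge0// exprn_ge0// ltW.
rewrite gtr0_norm// expRN ler_pdivrMr ?expR_gt0//.
have : t^-1 ^+ k.+2 / k.+2`!%:R <= expR t^-1.
  by apply: le_trans (expR_ge1Dxn k.+1 (ltW s0)); rewrite lerDr.
rewrite ler_pdivrMr ?ltr0n ?fact_gt0// => h.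
rewrite -(ler_pM2r (exprn_gt0 2 s0)) -exprD addn2 (le_trans h)//.
by rewrite le_eqVlt; apply/orP; left; apply/eqP; field; rewrite gt_eqF.
Qed.

Lemma is_derive_inv_expR k (t : R) : 0 < t ->
  is_derive t 1 (fun u => u^-1 ^+ k * expR (- u^-1))
    (- k%:R * (t^-1 ^+ k.+1 * expR (- t^-1)) + t^-1 ^+ k.+2 * expR (- t^-1)).
Proof.
move=> t0.
have dV : is_derive t 1 (fun u : R => u^-1) (- (t ^- 2)).
  apply: is_derive_eq; first by apply: is_deriveV; rewrite gt_eqF.
  by rewrite /GRing.scale /= mulr1.
have dE : is_derive t 1 (fun u : R => expR (- u^-1)) (t ^- 2 * expR (- t^-1)).
  apply: (is_derive_eq (is_derive1_comp (is_derive_expR _) (is_deriveN dV))).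
  by rewrite opprK mulrC.
have -> : (fun u : R => u^-1 ^+ k * expR (- u^-1)) =
    (fun u : R => u^-1) ^+ k * (fun u : R => expR (- u^-1)).
  by apply/funext => u; rewrite fctE exprfctE.
apply: (is_derive_eq (is_deriveM (is_deriveX k dV) dE)).
rewrite exprfctE /GRing.scale /= -exprVn.
by case: k => [|k]; rewrite ?mulr0n !exprS ?expr0; ring.
Qed.

Lemma is_diff_flat k (t : R^o) :
  is_diff t (flat k : R^o -> R^o)
    (fun h => (- k%:R * flat k.+1 t + flat k.+2 t) *: h).
Proof.
have [t0|t0|->] := ltgtP t 0.
- rewrite !flat_neg ?ltW// mulr0 addr0.
  apply: is_diff_eq; last by apply/funext => h; rewrite scale0r.
  apply: is_diff_near0; near=> y; rewrite flat_neg// ltW//.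
  by near: y; exact: lt_nbhsl.
- pose f := fun u : R => u^-1 ^+ k * expR (- u^-1).
  have e : \forall u \near t, f u = flat k u.
    near=> u; rewrite /flat ifT//; near: u; exact: lt_nbhsr.
  have df : is_derive (t : R) 1 f (- k%:R * flat k.+1 t + flat k.+2 t).
    by rewrite /flat t0; exact: is_derive_inv_expR.
  have ddf : differentiable (f : R^o -> R^o) t.
    by apply/derivable1_diffP; case: df.
  apply: is_diff_eq (near_eq_is_diff e ddf) _.
  apply/funext => h; rewrite diff1E// derive1E.
  by case: df => _ ->; rewrite /GRing.scale /= mulrC.
rewrite !flat_neg// mulr0 addr0.
apply: is_diff_eq; last by apply/funext => h; rewrite scale0r.
apply: is_diff_little => [|e e0]; first exact: flat_neg.
near=> y; rewrite (le_trans (flat_le _ _))// subr0 expr2 mulrA.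
rewrite ler_wpM2r// -ler_pdivlMl ?ltr0n ?fact_gt0//.
near: y; apply/nbhs_ballP; exists ((k.+2`!%:R)^-1 * e) => /=.
  by rewrite mulr_gt0// invr_gt0 ltr0n fact_gt0.
by move=> y; rewrite -ball_normE /= sub0r normrN => /ltW.
Unshelve. all: by end_near. Qed.

Lemma Cn_flat n k : Cn n [set: R^o] (flat k : R^o -> R^o).
Proof.
elim: n k => [|n IH] k.
  move=> t _; apply: differentiable_continuous.
  by have [] := is_diff_flat k t.
split; first by move=> t _; have [] := is_diff_flat k t.
have o : open ([set: R^o] `*` [set: R^o]) by apply: open_setXT; exact: openT.
have -> : (fun z : R^o * R^o => 'd (flat k : R^o -> R^o) (z.1 : R^o) z.2) =
  fun z : R^o * R^o => (- k%:R *: flat k.+1 z.1 + flat k.+2 z.1) *: z.2.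
  by apply/funext => z; have [_ ->] := is_diff_flat k z.1.
have cf j : Cn n ([set: R^o] `*` [set: R^o]) (fun z : R^o * R^o => flat j z.1 : R^o).
  exact: (Cn_comp o (fun _ _ => I) (@Cn_fst _ n R^o R^o _) (IH j)).
apply: Cn_scale => //; last exact: Cn_snd.
apply: Cn_add => //; apply: Cn_scale => //; exact: Cn_cst.
Qed.

End FlatFunction.

(** * Smooth vector fields with a prescribed value *)

Section Bump.
Context {R : realType} {E : completeNormedModType R}.
Hypothesis hilbE : exists2 g : E -> E -> R,
  inner_product g & forall x, `|x| = ip_norm g x.

(** The bump is [flat 0] applied to [e ^ 2 - |y - y0| ^ 2]. It is smooth because the squared norm is
    a continuous bilinear form on the diagonal. *)
Lemma bump_exists (y0 : E) (e : R) : 0 < e ->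
  exists phi : E -> R, [/\ forall n, Cn n [set: E] (phi : E -> R^o),
    phi y0 != 0 & forall y, phi y != 0 -> `|y - y0| < e].
Proof.
move=> e0; case: hilbE => g ipg gE.
have gxx (x : E) : g x x = `|x| ^+ 2 by rewrite gE ip_norm_sqr.
pose gM := bilinear_isBilinear.Build R E E R^o _ _ _ (ip_bilinear ipg).
pose gB : {bilinear E -> E -> R^o} := HB.pack (g : E -> E -> R^o) gM.
have gc : continuous (fun q : E * E => gB q.1 q.2).
  (* Polarization expresses the form through the norm, which gives its continuity. *)
  have -> : (fun q : E * E => gB q.1 q.2) =
      (fun q : E * E => (`|q.1 + q.2| ^+ 2 - `|q.1 - q.2| ^+ 2) / 4).
    apply/funext => q; rewrite -!gxx -[gB q.1 q.2]/(g q.1 q.2) !(ipE ipg).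
    by rewrite (ipC ipg q.2); field.
  move=> q; apply: cvgM; last exact: cvg_cst.
  have cf : (fun z : E * E => z.1) z @[z --> q] --> q.1 by exact: cvg_fst.
  have cs : (fun z : E * E => z.2) z @[z --> q] --> q.2 by exact: cvg_snd.
  under eq_fun do rewrite !expr2; rewrite !expr2.
  by apply: cvgB; apply: cvgM; apply: cvg_norm; (exact: cvgD || exact: cvgB).
have oT : open [set: E] by exact: openT.
exists (fun y => flat 0 (e ^+ 2 - g (y - y0) (y - y0))); split.
- move=> n; pose f (y : E) : R^o := e ^+ 2 - g (y - y0) (y - y0).
  suff cf : Cn n [set: E] f.
    exact: (Cn_comp oT (fun _ _ => I) cf (Cn_flat n 0)).
  have cs : Cn n [set: E] (fun y : E => y - y0).
    apply: Cn_add => //; last exact: Cn_cst.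
    by apply: (@Cn_lin _ _ _ _ _ idfun) => y; exact: cvg_id.
  have -> : f = fun y => (e ^+ 2 : R^o) + (-1 : R) *: (gB (y - y0) (y - y0)).
    by apply/funext => y; rewrite scaleN1r.
  apply: Cn_add => //; first exact: Cn_cst.
  apply: Cn_scale => //; first exact: Cn_cst.
  exact: (Cn_bilin (B := gB)).
- rewrite subrr (ip0l ipg) subr0 /flat exprn_gt0// expr0 mul1r.
  by rewrite gt_eqF// expR_gt0.
- move=> y; rewrite /flat; case: ifPn => [|_ /eqP//].
  by rewrite subr_gt0 gxx ltr_pXn2r// ?nnegrE// ltW.
Qed.

End Bump.

Section Charts.
Context {R : realType} {E : completeNormedModType R} {M : manifold E}.
Implicit Types c : chart E M.

Lemma chart_at_atlas (u : M) : atlas (chart_at u).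
Proof. by rewrite /chart_at; case: cid2. Qed.

Lemma chart_at_dom (u : M) : chart_dom (chart_at u) u.
Proof. by rewrite /chart_at; case: cid2. Qed.

Lemma chart_inv_preimage_open c (V : set M) : open V ->
  open (chart_cod c `&` chart_inv c @^-1` V).
Proof.
move=> oV; rewrite openE => x [cx Vx]; rewrite /interior.
apply: filterI; first exact: (open_nbhs_nbhs (conj (@chart_cod_open _ _ _ c) cx)).
apply: chart_inv_continuous => //.
exact: (open_nbhs_nbhs (conj oV Vx)).
Qed.

Lemma transition_open c c' :
  open (chart_cod c `&` (chart_inv c @^-1` chart_dom c')).
Proof. apply: chart_inv_preimage_open; exact: chart_dom_open. Qed.

Lemma transition_mem c c' u : chart_dom c u -> chart_dom c' u ->
  (chart_cod c `&` (chart_inv c @^-1` chart_dom c')) (c u).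
Proof.
by move=> cu cu'; split; [exact: chart_map_cod | rewrite /= chart_mapK].
Qed.

Lemma transition_differentiable c c' u : atlas c -> atlas c' ->
  chart_dom c u -> chart_dom c' u ->
  differentiable (fun x : E => c' (chart_inv c x)) (c u).
Proof.
move=> ac ac' cu c'u.
have [d _] := atlas_compatible ac ac' 1%N.
by apply: d; exact: transition_mem.
Qed.

(** This is the chain rule through [chart_at u], the chart in which vectors tangent at [u] are
    stored. *)
Lemma to_of_chart c c' (u : M) (v : E) : atlas c -> atlas c' ->
  chart_dom c u -> chart_dom c' u ->
  to_chart c' (of_chart c u v) = 'd (fun x : E => c' (chart_inv c x)) (c u) v.
Proof.
move=> ac ac' cu c'u; rewrite /to_chart /of_chart.
have cau := chart_at_dom u; have aca := chart_at_atlas u.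
set b := chart_at u in cau aca *.
pose f (x : E) := b (chart_inv c x); pose h (x : E) := c' (chart_inv b x).
have df : differentiable f (c u) by exact: transition_differentiable.
have fcu : f (c u) = b u by rewrite /f chart_mapK.
have dh : differentiable h (f (c u)).
  by rewrite fcu; exact: transition_differentiable.
have e : \forall x \near c u, (h \o f) x = c' (chart_inv c x).
  apply: filterS (open_nbhs_nbhs (conj (transition_open c b) _)).
    by move=> x [_ bx]; rewrite /h /f /= chart_mapK.
  exact: transition_mem.
have [_ ->] := near_eq_is_diff e (differentiable_comp df dh).
by rewrite diff_comp// fcu.
Qed.

Lemma of_chart_at (u : M) (v : E) : of_chart (chart_at u) u v = v.
Proof.
rewrite /of_chart; set b := chart_at u.
have e : \forall x \near b u, id x = b (chart_inv b x).
  apply: filterS (open_nbhs_nbhs (conj (@chart_cod_open _ _ _ b) _)).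
    by move=> x bx; rewrite chart_invK.
  by apply: chart_map_cod; exact: chart_at_dom.
have [_ ->] := near_eq_is_diff e (ex_diff (is_diff_def := is_diff_id (b u))).
by rewrite diff_val.
Qed.

(** Near a point of the domain of [b] the coordinates of the field are smooth by composition. The
    remaining points lie off [closure V], where the field is zero. *)
Lemma smooth_field_extension (u : M) (v : tangent u) :
  exists2 X : forall w : M, tangent w, smooth_field X & X u = v.
Proof.
set b := chart_at u; have bu : chart_dom b u := chart_at_dom u.
have ab : atlas b := chart_at_atlas u.
have nb : nbhs u (chart_dom b).
  exact: (open_nbhs_nbhs (conj (@chart_dom_open _ _ _ b) bu)).
(* Regularity gives a neighbourhood [V] of [u] whose closure stays inside the chart domain; the
   field will vanish outside [V]. *)
have [V Vu clV] := @manifold_regular _ _ M u _ nb.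
have [e e0 be] : exists2 e, 0 < e &
    forall y, `|y - b u| < e -> chart_cod b y -> V (chart_inv b y).
  have := @chart_inv_continuous _ _ _ b _ (chart_map_cod bu) V.
  rewrite chart_mapK// => /(_ Vu) /nbhs_ballP[e e0 h].
  by exists e => // y ye _; apply: h; rewrite -ball_normE /= distrC.
have [phi [cphi phi0 phie]] := bump_exists (@model_hilbert _ _ M) (b u) e0.
(* The bump is only known to be nonzero at its centre, so the constant vector is divided by its
   value there. *)
pose a := (phi (b u))^-1 *: (v : E).
pose X (w : M) : tangent w :=
  if pselect (chart_dom b w) then phi (b w) *: of_chart b w a else 0.
exists X; last first.
  rewrite /X; case: pselect => //= _.
  by rewrite of_chart_at /a scalerA mulfV// scale1r.
have X0 w : ~ V w -> X w = 0.
  move=> Vw; rewrite /X; case: pselect => //= bw.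
  have [->|/phie h] := eqVneq (phi (b w)) 0; first by rewrite scale0r.
  by have := be _ h (chart_map_cod bw); rewrite chart_mapK.
move=> c ac n; apply: Cn_local => x cx.
have [Bx|Bx] := pselect (chart_dom b (chart_inv c x)).
  pose B := chart_cod c `&` (chart_inv c @^-1` chart_dom b).
  have oB : open B by exact: transition_open.
  exists B; first by [].
  pose t (y : E) : E := b (chart_inv c y).
  have ct : Cn n B t by exact: atlas_compatible.
  (* The differential of a transition map is [C^n] because the map itself is [C^(n+1)]. *)
  pose h (z : E * E) := 'd (fun y : E => c (chart_inv b y)) (z.1 : E) z.2.
  have ch : Cn n ((chart_cod b `&` (chart_inv b @^-1` chart_dom c)) `*` setT) h.
    by have [] := atlas_compatible ab ac n.+1.
  apply: (@Cn_eq _ _ _ _ _ (fun y => phi (t y) *: h (t y, a))) => //.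
    move=> y [cy bcy]; rewrite /= /X; case: pselect => //= _.
    rewrite /to_chart linearZ; congr (_ *: _).
    rewrite -[RHS]/(to_chart c (of_chart b (chart_inv c y) a)) to_of_chart//.
    exact: chart_inv_dom.
  apply: Cn_scale => //.
    exact: (Cn_comp oB (fun _ _ => I) ct (cphi n)).
  have cta : Cn n B (fun y => (t y, a)).
    by apply: Cn_pair => //; exact: Cn_cst.
  apply: (Cn_comp oB _ cta ch) => y [cy bcy]; split=> //=.
  by apply: transition_mem => //; exact: chart_inv_dom.
pose B := chart_cod c `&` (chart_inv c @^-1` (~` closure V)).
have oB : open B.
  by apply: chart_inv_preimage_open; exact/closed_openC/closed_closure.
exists B; first by split=> // /clV.
apply: (@Cn_eq _ _ _ _ _ (fun=> 0)) => //; last exact: Cn_cst.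
move=> y [cy nV]; rewrite X0; first by rewrite /to_chart linear0.
by move=> Vy; apply: nV; exact: subset_closure.
Qed.

End Charts.

(** * Differentials of smooth maps and of a retraction *)

Section TangentMaps.
Context {R : realType} {E F : completeNormedModType R}.
Context {N : manifold F} {M : manifold E}.

Lemma smooth_map_differentiable (f : N -> M) (u : N) : smooth_map f ->
  differentiable (fun x : F => chart_at (f u) (f (chart_inv (chart_at u) x)))
    (chart_at u u).
Proof.
move=> [_ sf].
have [d _] := sf _ _ (chart_at_atlas u) (chart_at_atlas (f u)) 1%N.
apply: d; split; first exact/chart_map_cod/chart_at_dom.
by rewrite /= chart_mapK; exact: chart_at_dom.
Qed.

End TangentMaps.

(** In charts [p \o i] is the identity near the point, and the chain rule applies. The left side is
    typed as tangent at [p (i u)] and the right one at [u], so the equation is stated in their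
    common model [F]. *)
Lemma tangent_map_retraction (R : realType) (E F : completeNormedModType R)
    (N : manifold F) (M : manifold E) (i : N -> M) (p : M -> N) :
  smooth_map i -> smooth_map p -> (forall u, p (i u) = u) ->
  forall u (v : tangent u),
    tangent_map p (i u) (tangent_map i u v) = v :> F.
Proof.
move=> si sp pi u v; rewrite /tangent_map.
have di := smooth_map_differentiable u si.
have dp := smooth_map_differentiable (i u) sp.
(* Rewriting [p (i u)] to [u] turns the target chart of [p] into the source chart of [i]. *)
have := chart_at_dom (i u); move: di dp; rewrite !pi.
set b := chart_at u; set c := chart_at (i u) => di dp ciu.
have bu : chart_dom b u := chart_at_dom u.
pose f (x : F) := c (i (chart_inv b x)); pose h (x : E) := b (p (chart_inv c x)).
have fbu : f (b u) = c (i u) by rewrite /f chart_mapK.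
have dp' : differentiable h (f (b u)) by rewrite fbu.
have e : \forall x \near b u, (h \o f) x = id x.
  have ci : continuous i by case: si.
  have oV : open (i @^-1` chart_dom c).
    apply: open_comp; last exact: chart_dom_open.
    by move=> x _; exact: ci.
  apply: filterS (open_nbhs_nbhs (conj (chart_inv_preimage_open b oV) _)).
    by move=> x [bx cx]; rewrite /h /f /= chart_mapK// pi chart_invK.
  by split; [exact: chart_map_cod | rewrite /= chart_mapK].
have [_ dE] := near_eq_is_diff e (differentiable_comp di dp').
rewrite -fbu.
have := congr1 (fun k => k v) dE; rewrite diff_comp// diff_val /=.
by move=> <-.
Qed.

(** * Symmetric operators *)

Section Hilbert.
Context {R : realType} {H : lmodType R} {g : H -> H -> R}.

(** The solution is the limit of the iterates of [x |-> y + S x] from 0, which are the partial sums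
    of the Neumann series. *)
Lemma neumann_solvable (S : {linear H -> H}) q : hilbert_space g ->
  0 <= q -> q < 1 -> (forall x, ip_norm g (S x) <= q * ip_norm g x) ->
  forall y, exists x, x - S x = y.
Proof.
move=> [ipg complete] q0 q1 Sq y.
pose s := fix s n := if n is m.+1 then y + S (s m) else 0.
(* This solves [C = |y| + q C], so the iteration preserves the bound. *)
pose C := ip_norm g y / (1 - q).
have q1' : 0 < 1 - q by rewrite subr_gt0.
have sC n : ip_norm g (s n) <= C.
  elim: n => [|n IH]; first by rewrite (ip_norm0 ipg) divr_ge0 ?ip_norm_ge0// ltW.
  apply: (le_trans (ip_norm_triangle ipg _ _)).
  have -> : C = ip_norm g y + q * C by rewrite /C; field; rewrite gt_eqF.
  by rewrite lerD2l (le_trans (Sq _))// ler_wpM2l.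
have sq n k : ip_norm g (s (n + k)%N - s n) <= q ^+ n * C.
  elim: n => [|n IH]; first by rewrite subr0 expr0 mul1r.
  rewrite addSn /= opprD addrACA subrr add0r -linearB.
  by rewrite (le_trans (Sq _))// exprS -mulrA ler_wpM2l.
have small e : 0 < e -> exists N, q ^+ N * C < e.
  move=> e0; have : (fun n => q ^+ n * C) @ \oo --> 0 * C.
    by apply: cvgMl; apply: cvg_expr; rewrite ger0_norm.
  rewrite mul0r => /cvgrPdist_lt /(_ e e0) [N _ hN]; exists N.
  have := hN N (leqnn N); rewrite /= sub0r normrN; apply: le_lt_trans.
  exact: ler_norm.
have [l sl] : exists l, forall e, 0 < e -> exists N, forall n, (N <= n)%N ->
    ip_norm g (s n - l) < e.
  apply: complete => e e0; have [|N hN] := small (e / 2); first by rewrite divr_gt0.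
  have hs m : (N <= m)%N -> ip_norm g (s m - s N) < e / 2.
    by move=> Nm; rewrite -(subnKC Nm) (le_lt_trans (sq _ _)).
  exists N => m n Nm Nn.
  have -> : s m - s n = (s m - s N) + (s N - s n) by rewrite addrA subrK.
  rewrite (le_lt_trans (ip_norm_triangle ipg _ _))// [ltRHS]splitr.
  by rewrite ltrD ?hs// (ip_norm_sub ipg) hs.
exists l; apply/subr0_eq; apply: (ip_norm_eq0_small ipg) => e e0.
have [|N hN] := sl (e / 2); first by rewrite divr_gt0.
have -> : l - S l - y = (l - s N.+1) + S (s N - l).
  by rewrite linearB /= opprD !addrA subrK addrAC.
rewrite (le_lt_trans (ip_norm_triangle ipg _ _))// [ltRHS]splitr ltrD//.
  by rewrite (ip_norm_sub ipg) hN.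
rewrite (le_lt_trans (Sq _))// (le_lt_trans _ (hN N _))//.
by rewrite ler_piMl ?ip_norm_ge0// ltW.
Qed.

(* Were m = |T| > c, the hypothesis would give a lower bound on
   |T^2 w - m^2 w| = |(T - m) (T + m) w|; but |T^2 w - m^2 w|^2 =
   |T^2 w|^2 - 2 m^2 |T w|^2 + m^4 |w|^2 is small when |T w| is close to
   m |w|. *)
Lemma symmetric_norm_le (T : {linear H -> H}) c : inner_product g ->
  (forall x y, g (T x) y = g x (T y)) ->
  (exists C, forall x, ip_norm g (T x) <= C * ip_norm g x) ->
  0 <= c ->
  (forall m, c < m -> exists2 e, 0 < e &
     forall x, e * ip_norm g (T x) <= ip_norm g (T x - m *: x) /\
               e * ip_norm g (T x) <= ip_norm g (T x + m *: x)) ->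
  forall x, ip_norm g (T x) <= c * ip_norm g x.
Proof.
move=> ipg Tsym [C TC] c0 Tlow.
have nrm := @ip_norm_ge0 _ _ g.
pose B := [set ip_norm g (T x) | x in [set x | ip_norm g x <= 1]].
have B0 : B 0 by exists 0; rewrite /= ?linear0 (ip_norm0 ipg).
have supB : has_sup B.
  split; first by exists 0.
  exists `|C| => _ [x /= x1 <-]; rewrite (le_trans (TC x))//.
  by rewrite (le_trans (ler_norm _))// normrM (ger0_norm (nrm x)) ler_piMr.
(* [m] is the operator norm of [T]. *)
pose m := sup B.
have Tm x : ip_norm g (T x) <= m * ip_norm g x.
  have [->|x0] := eqVneq x 0; first by rewrite linear0 !(ip_norm0 ipg) mulr0.
  have nx : 0 < ip_norm g x.
    rewrite lt_neqAle nrm andbT eq_sym; apply: contra x0 => /eqP/(ip_norm_eq0 ipg)->.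
    by rewrite eqxx.
  rewrite -ler_pdivrMr//.
  have -> : ip_norm g (T x) / ip_norm g x = ip_norm g (T ((ip_norm g x)^-1 *: x)).
    by rewrite linearZ /= (ip_normZ ipg) gtr0_norm ?invr_gt0// mulrC.
  apply: ub_le_sup; first by case: supB.
  exists ((ip_norm g x)^-1 *: x) => //=.
  by rewrite (ip_normZ ipg) gtr0_norm ?invr_gt0// mulVf// gt_eqF.
move=> x; apply: le_trans (Tm x) _; rewrite ler_wpM2r//.
have [//|cm] := leP m c; exfalso.
have m0 : 0 < m by exact: le_lt_trans cm.
have [e e0 He] := Tlow m cm.
(* [K] comes from using the lower bound twice and squaring. At the end of [main], [k <= K / 4] makes
   the two estimates of [K * a ^ 2] collide, and [k <= 1 / 2] ensures [a > m ^ 2 * b / 2]. *)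
pose K := e ^+ 4; have K0 : 0 < K by exact: exprn_gt0.
pose k := Num.min (1 / 2) (K / 4).
have k0 : 0 < k by rewrite lt_min !divr_gt0.
have k12 : k <= 1 / 2 by rewrite ge_min lexx.
have kK : k <= K / 4 by rewrite ge_min lexx orbT.
clearbody k.
have main w : g (T w) (T w) <= (1 - k) * m ^+ 2 * g w w.
  set a := g (T w) (T w); set b := g w w; set d := g (T (T w)) (T (T w)).
  have b0 : 0 <= b by exact: ip_ge0.
  have a0 : 0 <= a by exact: ip_ge0.
  have d0 : 0 <= d by exact: ip_ge0.
  have dm : d <= m ^+ 2 * a.
    by rewrite /d /a -!(ip_norm_sqr ipg) -exprMn ler_pXn2r// ?nnegrE ?mulr_ge0// ltW.
  have abd : a ^+ 2 <= d * b.
    by rewrite /a Tsym (ipC ipg); exact: ip_cauchy_schwarz.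
  have TD : T (T w + m *: w) = T (T w) + m *: T w by rewrite linearD linearZ.
  have Kd : K * d <= d - 2 * m ^+ 2 * a + m ^+ 4 * b.
    have -> : d - 2 * m ^+ 2 * a + m ^+ 4 * b =
        ip_norm g (T (T w + m *: w) - m *: (T w + m *: w)) ^+ 2.
      rewrite (ip_norm_sqr ipg) TD scalerDr scalerA opprD addrA addrK.
      rewrite !(ipE ipg) (Tsym (T w) w) (ipC ipg w (T (T w))) (Tsym (T w) w).
      by rewrite -/a -/b -/d; ring.
    (* The two signs are used in turn: [T - m] on [v = T w + m w], and [T + m] on [T w], whose image
       is [T v]. *)
    have h1 := (He (T w + m *: w)).1; have h2 := (He (T w)).2.
    rewrite -TD in h2.
    have h3 : e ^+ 2 * ip_norm g (T (T w)) <=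
       ip_norm g (T (T w + m *: w) - m *: (T w + m *: w)).
      by apply: le_trans h1; rewrite expr2 -mulrA ler_wpM2l// ltW.
    rewrite /K /d -(ip_norm_sqr ipg) (exprM e 2 2) -exprMn.
    have e2 : 0 <= e ^+ 2 by exact: sqr_ge0.
    rewrite ler_pXn2r// nnegrE; [exact: mulr_ge0 | exact: nrm].
  rewrite leNgt; apply/negP => lta.
  have b1 : 0 < b.
    rewrite lt_neqAle b0 andbT; apply/negP => /eqP be.
    move: abd lta; rewrite -be !mulr0 => a2 a1.
    by have := exprn_gt0 2 a1; rewrite ltNge a2.
  have m2 : 0 < m ^+ 2 by exact: exprn_gt0.
  have h1 : m ^+ 2 * b / 2 < a.
    apply: le_lt_trans lta.
    have : 1 / 2 * (m ^+ 2 * b) <= (1 - k) * (m ^+ 2 * b).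
      by apply: ler_wpM2r; [apply: mulr_ge0 => //; exact: ltW | lra].
    lra.
  have h2 : K * (m ^+ 2 * b / 2) ^+ 2 < K * a ^+ 2.
    rewrite ltr_pM2l// ltr_pXn2r// nnegrE//.
    by rewrite divr_ge0// mulr_ge0// ltW.
  have h3 : K * a ^+ 2 <= b * (m ^+ 2 * (m ^+ 2 * b - a)).
    apply: (@le_trans _ _ (b * (K * d))).
      by rewrite [leRHS]mulrCA ler_pM2l// [leRHS]mulrC.
    rewrite ler_pM2l// (le_trans Kd)//.
    by move: dm; lra.
  have h4 : b * (m ^+ 2 * (m ^+ 2 * b - a)) < b * (m ^+ 2 * (K / 4 * (m ^+ 2 * b))).
    rewrite !ltr_pM2l//.
    have : k * (m ^+ 2 * b) <= K / 4 * (m ^+ 2 * b).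
      by rewrite ler_wpM2r// mulr_ge0// ltW.
    move: lta; rewrite -mulrA mulrBl mul1r; lra.
  have := lt_trans (lt_le_trans h2 h3) h4.
  rewrite -subr_gt0; set z := (X in 0 < X); have -> : z = 0 by rewrite /z; field.
  by rewrite ltxx.
have k1 : 0 < 1 - k by lra.
(* By [main], [m'] is an upper bound of [B], yet it is smaller than the supremum [m]. *)
pose m' := Num.sqrt (1 - k) * m.
have m'0 : 0 <= m' by rewrite mulr_ge0 ?sqrtr_ge0// ltW.
have : m <= m'.
  apply: ge_sup; first by exists 0.
  move=> _ [w /= w1 <-]; apply: ip_norm_le => //.
  rewrite exprMn sqr_sqrtr; last exact: ltW.
  apply: (le_trans (main w)); apply: ler_piMr.
    by apply: mulr_ge0; [exact: ltW | exact: sqr_ge0].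
  by rewrite -(ip_norm_sqr ipg) exprn_ile1.
apply/negP; rewrite -ltNge /m' gtr_pMl//.
by rewrite -[ltRHS]sqrtr1 ltr_sqrt//; lra.
Qed.

End Hilbert.

(** * Resolvent estimates for unbounded symmetric operators *)

Section SymmetricOperators.
Context {R : realType} {H : lmodType R} {g : H -> H -> R}.

Definition symmetric_op (A : operator H) : Prop :=
  forall x y, op_dom A x -> op_dom A y -> g (A x) y = g x (A y).

Lemma cplx_norm_abs (l : R[i]) :
  complex.Re `|l| = Num.sqrt (complex.Re l ^+ 2 + complex.Im l ^+ 2).
Proof. by case: l. Qed.

Lemma op_domB (A : operator H) x y : op_dom A x -> op_dom A y ->
  op_dom A (x - y).
Proof.
by move=> dx dy; rewrite addrC -scaleN1r; exact: op_domP.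
Qed.

Lemma op_domD (A : operator H) x y : op_dom A x -> op_dom A y ->
  op_dom A (x + y).
Proof. by move=> dx dy; rewrite -[x]scale1r; exact: op_domP. Qed.

Lemma op_domZ (A : operator H) a x : op_dom A x -> op_dom A (a *: x).
Proof.
by move=> dx; rewrite -[_ *: _]addr0; apply: op_domP => //; exact: op_dom0.
Qed.

Lemma op_funD (A : operator H) x y : op_dom A x -> op_dom A y ->
  A (x + y) = A x + A y.
Proof. by move=> dx dy; rewrite -[x in LHS]scale1r op_linear// scale1r. Qed.

Lemma op_fun0 (A : operator H) : A 0 = 0.
Proof.
have := op_funD (op_dom0 A) (op_dom0 A); rewrite addr0 => /eqP.
by rewrite -[X in X == _]addr0 (inj_eq (addrI _)) eq_sym => /eqP.
Qed.

Lemma op_funB (A : operator H) x y : op_dom A x -> op_dom A y ->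
  A (x - y) = A x - A y.
Proof.
move=> dx dy; rewrite addrC -scaleN1r op_linear// scaleN1r addrC //.
Qed.

Lemma resolvent_of_radius (A : operator H) r (l : R[i]) :
  (spectral_radius g A <= r%:E)%E -> r < complex.Re `|l| -> resolvent_set g A l.
Proof.
move=> Ar rl; apply: contrapT => nl.
have : ((complex.Re `|l|)%:E <= r%:E)%E.
  by apply: le_trans Ar; apply: ereal_sup_ubound; right; exists l.
by rewrite lee_fin leNgt rl.
Qed.

Hypothesis ipg : inner_product g.

(** For real [t] the complexified shift acts on real and imaginary parts separately, so the real
    part of [B (w, 0)] inverts [A - t] on [H]. *)
Lemma real_resolvent (A : operator H) r t :
  (spectral_radius g A <= r%:E)%E -> r < `|t| ->
  exists T : {linear H -> H},
    [/\ forall x, op_dom A x -> T (A x - t *: x) = x,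
        forall w, op_dom A (T w) /\ A (T w) - t *: T w = w
      & exists2 C, 0 < C & forall w, ip_norm g (T w) <= C * ip_norm g w].
Proof.
move=> Ar rt.
have [|B [BK KB [C BC]]] := resolvent_of_radius (l := t%:C%C) Ar.
  by rewrite cplx_norm_abs /= expr0n addr0 sqrtr_sqr.
have shiftE (z : H * H) :
    cplx_shift A t%:C%C z = (A z.1 - t *: z.1, A z.2 - t *: z.2).
  by rewrite /cplx_shift /= !scale0r subr0 addr0.
pose T w := (B (w, 0)).1.
have TA x : op_dom A x -> T (A x - t *: x) = x.
  move=> dx; have := BK (x, 0) (conj dx (op_dom0 A)).
  by rewrite shiftE /= op_fun0 scaler0 subr0 /T => ->.
have AT w : op_dom A (T w) /\ A (T w) - t *: T w = w.
  by have [[d1 _]] := KB (w, 0); rewrite shiftE => -[].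
have Tlin : linear T.
  move=> a x y; have [dx ex] := AT x; have [dy ey] := AT y.
  rewrite -[in LHS]ex -[in LHS]ey; rewrite -[RHS]TA; last exact: op_domP.
  congr T; rewrite op_linear// scalerDr scalerN scalerDr opprD !scalerA.
  by rewrite (mulrC t) addrACA.
pose TM := GRing.isLinear.Build _ _ _ _ _ Tlin.
pose TL : {linear _ -> _} := HB.pack T TM.
(* Adding 1 makes the constant positive; its inverse serves later as a lower bound. *)
exists TL; split=> //; exists (`|C| + 1) => [|w].
  by rewrite ltr_wpDl.
have n0 : cplx_norm g (w, 0) = ip_norm g w.
  by rewrite /cplx_norm /= (ip0l ipg) addr0.
have h1 : ip_norm g (T w) <= cplx_norm g (B (w, 0)).
  by rewrite ler_wsqrtr// lerDl (ip_ge0 ipg).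
apply: (le_trans h1); apply: (le_trans (BC _)).
rewrite n0; apply: ler_wpM2r; first exact: ip_norm_ge0.
by apply: (le_trans (ler_norm C)); rewrite lerDl.
Qed.

(** The resolvent [T] of [A] at [t] is bounded and symmetric, so [symmetric_norm_le] applies with
    [c = 1 / (|t| - r)]. For [m > c] and [s = 1 / m] or [s = - 1 / m] one still has [|t + s| > r],
    and the bounded inverses at these [t + s] give the lower bounds for [T - m] and [T + m]. *)
Lemma symmetric_shift_lower_bound (A : operator H) r t : 0 <= r ->
  (spectral_radius g A <= r%:E)%E -> symmetric_op A -> r < `|t| ->
  forall x, op_dom A x -> (`|t| - r) * ip_norm g x <= ip_norm g (A x - t *: x).
Proof.
move=> r0 Ar Asym rt.
have [T [TA AT [C C0 TC]]] := real_resolvent Ar rt.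
have tr : 0 < `|t| - r by rewrite subr_gt0.
suff Tle w : ip_norm g (T w) <= (`|t| - r)^-1 * ip_norm g w.
  move=> x dx; have := Tle (A x - t *: x).
  by rewrite TA// [leRHS]mulrC ler_pdivlMr// mulrC.
move: w; apply: symmetric_norm_le => //.
- move=> x y; have [dx ex] := AT x; have [dy ey] := AT y.
  rewrite -{2}ex -{1}ey !(ipE ipg) Asym//.
- by exists C.
- by rewrite invr_ge0 ltW.
move=> m hm; have m0 : 0 < m by apply: lt_trans hm; rewrite invr_gt0.
have mi : m^-1 < `|t| - r by rewrite -ltf_pV2 ?posrE ?invr_gt0// invrK.
have low s : `|s| = m^-1 -> exists2 e, 0 < e & forall w,
    e * ip_norm g (T w) <= ip_norm g (w - s *: T w).
  move=> sm; have rts : r < `|t + s|.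
    have := ler_normB (t + s) s; rewrite addrK sm; lra.
  have [T' [TA' _ [C' C0' TC']]] := real_resolvent Ar rts.
  exists C'^-1 => [|w]; first by rewrite invr_gt0.
  have [dx ex] := AT w; rewrite ler_pdivrMl//.
  have -> : w - s *: T w = A (T w) - (t + s) *: T w.
    by rewrite -{1}ex scalerDl opprD addrA.
  by rewrite -{1}(TA' (T w))//; exact: TC'.
have [|e1 e10 h1] := low m^-1; first by rewrite gtr0_norm// invr_gt0.
have [|e2 e20 h2] := low (- m^-1); first by rewrite normrN gtr0_norm// invr_gt0.
exists (m * Num.min e1 e2); first by rewrite mulr_gt0// lt_min e10.
move=> w; have nw := ip_norm_ge0 (g := g) (T w).
(* Factoring out [- s] turns [1 - s T] into a multiple of [T - 1 / s], where [1 / s] is [m] or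
   [- m]. *)
have mm (s : R) : s = m^-1 \/ s = - m^-1 ->
  ip_norm g (w - s *: T w) = m^-1 * ip_norm g (T w - s^-1 *: w).
  move=> hs; have s0 : s != 0 by case: hs => ->; rewrite ?oppr_eq0 invr_eq0 gt_eqF.
  have -> : m^-1 = `|- s|.
    by rewrite normrN; case: hs => ->; rewrite ?normrN gtr0_norm// invr_gt0.
  by rewrite -(ip_normZ ipg) scalerBr !scaleNr scalerA mulfV// scale1r opprK addrC.
have := h1 w; rewrite (mm m^-1); last by left.
have := h2 w; rewrite (mm (- m^-1)); last by right.
rewrite invrN invrK scaleNr opprK !ler_pdivlMl// => g2 g1.
split; [apply: le_trans g1 | apply: le_trans g2].
  rewrite -mulrA; apply: ler_wpM2l; first exact: ltW.
  by apply: ler_wpM2r => //; rewrite ge_min lexx.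
rewrite -mulrA; apply: ler_wpM2l; first exact: ltW.
by apply: ler_wpM2r => //; rewrite ge_min lexx orbT.
Qed.

Lemma affine_bound_le0 (r p q : R) : (forall t, r < t -> 2 * t * p <= q) -> p <= 0.
Proof.
move=> h; rewrite leNgt; apply/negP => p0.
(* This [t] exceeds [r] and makes [2 * t * p] equal to [2 * (|r| * p + |q| + p)], which is larger
   than [q]. *)
pose t := `|r| + `|q| / p + 1.
have q0 : 0 <= `|q| / p by rewrite divr_ge0// ltW.
have rt : r < t by have := ler_norm r; rewrite /t; lra.
have := h t rt; apply/negP; rewrite -ltNge.
have -> : 2 * t * p = 2 * (`|r| * p + `|q| + p) by rewrite /t; field; rewrite gt_eqF.
have : 0 <= `|r| * p by rewrite mulr_ge0// ltW.
have := ler_norm q; have := normr_ge0 q; lra.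
Qed.

(** When the lower bounds at [t] and [- t] are squared, the terms in [t ^ 2] cancel. What remains is
    affine in [t], and [affine_bound_le0] gives the sign of the slope. *)
Lemma symmetric_numerical_range (A : operator H) r : 0 <= r ->
  (spectral_radius g A <= r%:E)%E -> symmetric_op A ->
  forall x, op_dom A x -> `|g (A x) x| <= r * g x x.
Proof.
move=> r0 Ar Asym x dx.
have low t : r < `|t| ->
    (`|t| - r) ^+ 2 * g x x <= g (A x) (A x) - 2 * t * g (A x) x + t ^+ 2 * g x x.
  move=> rt; have tr : 0 <= `|t| - r by rewrite subr_ge0 ltW.
  have := symmetric_shift_lower_bound r0 Ar Asym rt dx.
  rewrite -(@ler_pXn2r _ 2)// ?nnegrE ?mulr_ge0 ?ip_norm_ge0//.
  rewrite exprMn !(ip_norm_sqr ipg) !(ipE ipg) (ipC ipg x (A x)).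
  by congr (_ <= _); ring.
have t0 t : r < t -> 0 < t by exact: le_lt_trans.
rewrite ler_norml; apply/andP; split.
  suff : - g (A x) x - r * g x x <= 0 by lra.
  apply: (@affine_bound_le0 r _ (g (A x) (A x) - r ^+ 2 * g x x)) => t rt.
  have := low (- t); rewrite normrN (gtr0_norm (t0 t rt)) => /(_ rt).
  have -> : (t - r) ^+ 2 = t ^+ 2 - 2 * t * r + r ^+ 2 by ring.
  rewrite sqrrN; lra.
suff : g (A x) x - r * g x x <= 0 by lra.
apply: (@affine_bound_le0 r _ (g (A x) (A x) - r ^+ 2 * g x x)) => t rt.
have := low t; rewrite (gtr0_norm (t0 t rt)) => /(_ rt).
have -> : (t - r) ^+ 2 = t ^+ 2 - 2 * t * r + r ^+ 2 by ring.
lra.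
Qed.

(** Polarization bounds [2 <A x, y>] by [r (|x|^2 + |y|^2)] for [y] in the domain, and [y = c A x]
    with [c = |x| / |A x|] would give the claim. As [A x] may lie outside the domain, density
    supplies approximations. *)
Lemma symmetric_bound (A : operator H) r : 0 <= r -> symmetric_op A ->
  (forall x e, 0 < e -> exists2 z, op_dom A z & ip_norm g (x - z) < e) ->
  (forall x, op_dom A x -> `|g (A x) x| <= r * g x x) ->
  forall x, op_dom A x -> ip_norm g (A x) <= r * ip_norm g x.
Proof.
move=> r0 Asym Adense Ar x dx.
have pol y : op_dom A y -> 2 * g (A x) y <= r * (g x x + g y y).
  move=> dy; have := Ar (x + y) (op_domD dx dy); have := Ar (x - y) (op_domB dx dy).
  rewrite !ler_norml op_funB// op_funD// !(ipE ipg) (Asym y x)// (ipC ipg y (A x)).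
  rewrite (ipC ipg y x) => /andP[h1 _] /andP[_ h2]; lra.
set u := A x.
have pol' c : 0 <= c -> 2 * (c * g u u) <= r * (g x x + c ^+ 2 * g u u).
  move=> c0; apply/ler_addgt0Pr => e e0.
  set n := ip_norm g u; have n0 : 0 <= n by exact: ip_norm_ge0.
  (* [d * k] dominates the total error made when [c *: u] is replaced by a [y] in the domain at
     distance less than [d <= 1]. *)
  pose k := 2 * n + r * (2 * (c * n) + 1) + 1.
  have k0 : 0 < k by rewrite ltr_wpDl// addr_ge0 ?mulr_ge0// addr_ge0// !mulr_ge0.
  pose d := Num.min 1 (e / k).
  have d0 : 0 < d by rewrite lt_min ltr01 divr_gt0.
  have d1 : d <= 1 by rewrite ge_min lexx.
  have dk : d * k <= e by rewrite -ler_pdivlMr// ge_min lexx orbT.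
  have [y dy yd] := Adense (c *: u) d d0.
  have h1 := pol y dy.
  have h2 : g u (c *: u) <= g u y + n * d.
    have -> : g u (c *: u) = g u y + g u (c *: u - y) by rewrite (ipBr ipg) addrC subrK.
    rewrite lerD2l (le_trans (ler_norm _))// (le_trans (ip_abs_le ipg _ _))//.
    by rewrite ler_wpM2l// ltW.
  have h3 : g y y <= (c * n + d) ^+ 2.
    rewrite -(ip_norm_sqr ipg) ler_pXn2r// ?nnegrE ?ip_norm_ge0//; last first.
      by rewrite addr_ge0 ?mulr_ge0// ltW.
    have -> : y = c *: u + (y - c *: u) by rewrite addrC subrK.
    rewrite (le_trans (ip_norm_triangle ipg _ _))// (ip_normZ ipg) ger0_norm//.
    by rewrite lerD2l (ip_norm_sub ipg) ltW.
  have h4 : (c * n + d) ^+ 2 <= c ^+ 2 * g u u + d * (2 * (c * n) + 1).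
    rewrite -(ip_norm_sqr ipg) -/n sqrrD exprMn.
    have : d ^+ 2 <= d by rewrite expr2 ler_piMl// ltW.
    lra.
  have h5 : r * (g x x + g y y) <=
      r * (g x x + c ^+ 2 * g u u) + d * (r * (2 * (c * n) + 1)).
    rewrite mulrCA -mulrDr ler_wpM2l// -addrA lerD2l.
    exact: le_trans h3 h4.
  move: h2; rewrite (ipZr ipg) => h2.
  have : d * k = d * (2 * n) + d * (r * (2 * (c * n) + 1)) + d.
    by rewrite /k; ring.
  rewrite -/u in h1; lra.
have [u0|u0] := eqVneq u 0.
  by rewrite u0 (ip_norm0 ipg) mulr_ge0// ip_norm_ge0.
have nu : 0 < ip_norm g u.
  rewrite lt_neqAle ip_norm_ge0 andbT eq_sym; apply: contra u0.
  by move=> /eqP/(ip_norm_eq0 ipg)->.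
have nx : 0 < ip_norm g x.
  rewrite lt_neqAle ip_norm_ge0 andbT eq_sym; apply: contra u0.
  by move=> /eqP/(ip_norm_eq0 ipg) x0; rewrite /u x0 op_fun0.
(* This [c] balances the right-hand side: both of its terms become [r * |x| ^ 2]. *)
have := pol' (ip_norm g x / ip_norm g u); rewrite divr_ge0 ?ip_norm_ge0// => /(_ isT).
rewrite -!(ip_norm_sqr ipg).
have -> : 2 * (ip_norm g x / ip_norm g u * ip_norm g u ^+ 2) =
   2 * ip_norm g x * ip_norm g u by field; rewrite gt_eqF.
have -> : r * (ip_norm g x ^+ 2 + (ip_norm g x / ip_norm g u) ^+ 2 * ip_norm g u ^+ 2)
   = 2 * ip_norm g x * (r * ip_norm g x) by field; rewrite gt_eqF.
by rewrite ler_pM2l// mulr_gt0.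
Qed.

End SymmetricOperators.

(** * Bounded operators and their complexification *)

Section BoundedOperators.
Context {R : realType} {H : lmodType R} {g : H -> H -> R}.
Hypothesis hilb : hilbert_space g.
Let ipg : inner_product g := proj1 hilb.

(** The real part of the Hermitian product of the complexification, which is thus treated as a real
    Hilbert space; its [ip_norm] is [cplx_norm g]. *)
Definition cplx_ip (z w : H * H) : R := g z.1 w.1 + g z.2 w.2.

Lemma cplx_hilbert : hilbert_space cplx_ip.
Proof.
have ip2 : inner_product cplx_ip.
  split=> [z w|a z w v|z z0].
  - by rewrite /cplx_ip !(ipC ipg (w.1)) !(ipC ipg (w.2)).
  - by rewrite /cplx_ip /= !(ipE ipg); ring.
  - rewrite lt_neqAle addr_ge0 ?(ip_ge0 ipg)// andbT eq_sym.
    rewrite paddr_eq0 ?(ip_ge0 ipg)// negb_and !neq_lt !(ip_gt0 ipg).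
    case: z z0 => a b; rewrite /eq_op /= negb_and.
    by case/orP => ->; rewrite ?orbT.
split=> // s cs.
have le1 z : ip_norm g z.1 <= ip_norm cplx_ip z.
  by rewrite ler_wsqrtr// lerDl (ip_ge0 ipg).
have le2 z : ip_norm g z.2 <= ip_norm cplx_ip z.
  by rewrite ler_wsqrtr// lerDr (ip_ge0 ipg).
have le3 z : ip_norm cplx_ip z <= ip_norm g z.1 + ip_norm g z.2.
  apply: (ip_norm_le ip2); first by rewrite addr_ge0// ip_norm_ge0.
  rewrite sqrrD !(ip_norm_sqr ipg) /cplx_ip.
  have : 0 <= ip_norm g z.1 * ip_norm g z.2 by rewrite mulr_ge0// ip_norm_ge0.
  lra.
have [|l1 h1] := hilb.2 (fun n => (s n).1).
  move=> e /cs[N hN]; exists N => m n Nm Nn.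
  exact: le_lt_trans (le1 (s m - s n)) (hN m n Nm Nn).
have [|l2 h2] := hilb.2 (fun n => (s n).2).
  move=> e /cs[N hN]; exists N => m n Nm Nn.
  exact: le_lt_trans (le2 (s m - s n)) (hN m n Nm Nn).
exists (l1, l2) => e e0.
have e2 : 0 < e / 2 by rewrite divr_gt0.
have [N1 hN1] := h1 _ e2; have [N2 hN2] := h2 _ e2.
exists (maxn N1 N2) => n; rewrite geq_max => /andP[n1 n2].
by rewrite (le_lt_trans (le3 _))// [ltRHS]splitr ltrD// ?hN1 ?hN2.
Qed.

(* The product (a + i b) z in the complexification. *)
Definition cplx_scale (a b : R) (z : H * H) : H * H :=
  (a *: z.1 - b *: z.2, a *: z.2 + b *: z.1).

Lemma cplx_scale_norm a b z :
  ip_norm cplx_ip (cplx_scale a b z) =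
  Num.sqrt (a ^+ 2 + b ^+ 2) * ip_norm cplx_ip z.
Proof.
rewrite /ip_norm -sqrtrM ?addr_ge0 ?sqr_ge0//; congr Num.sqrt.
by rewrite /cplx_ip /cplx_scale /= !(ipE ipg) (ipC ipg z.2 z.1); ring.
Qed.

(** The estimate [|(A - l) z| >= (|l| - r) |z|] gives injectivity and the bound on the inverse;
    surjectivity comes from the Neumann series of [A / l]. *)
Lemma bounded_resolvent (A : operator H) r (l : R[i]) : 0 <= r ->
  (forall x, op_dom A x) ->
  (forall x, ip_norm g (A x) <= r * ip_norm g x) ->
  r < complex.Re `|l| -> resolvent_set g A l.
Proof.
move=> r0 domA Ar; rewrite cplx_norm_abs.
set a := complex.Re l; set b := complex.Im l; set n := Num.sqrt _ => rn.
have [ip2 comp2] := cplx_hilbert.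
have n0 : 0 < n by exact: le_lt_trans rn.
have nn : n ^+ 2 = a ^+ 2 + b ^+ 2 by rewrite sqr_sqrtr// addr_ge0// sqr_ge0.
have ab0 : a ^+ 2 + b ^+ 2 != 0 by rewrite -nn expf_neq0// gt_eqF.
pose A2 (z : H * H) : H * H := (A z.1, A z.2).
have A2r z : ip_norm cplx_ip (A2 z) <= r * ip_norm cplx_ip z.
  apply: (ip_norm_le ip2); first by rewrite mulr_ge0// ip_norm_ge0.
  rewrite exprMn (ip_norm_sqr ip2) /cplx_ip /= -!(ip_norm_sqr ipg) mulrDr -!exprMn.
  by rewrite lerD// ler_pXn2r// ?nnegrE ?mulr_ge0 ?ip_norm_ge0.
have shiftE z : cplx_shift A l z = A2 z - cplx_scale a b z by [].
have low z : (n - r) * ip_norm cplx_ip z <= ip_norm cplx_ip (cplx_shift A l z).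
  have : ip_norm cplx_ip (cplx_scale a b z) <=
      ip_norm cplx_ip (cplx_shift A l z) + ip_norm cplx_ip (A2 z).
    rewrite shiftE (ip_norm_sub ip2 (A2 z)).
    by apply: le_trans (ip_norm_triangle ip2 _ _); rewrite subrK.
  by rewrite cplx_scale_norm -/n; have := A2r z; lra.
have nr : 0 < n - r by rewrite subr_gt0.
have shiftB z w : cplx_shift A l (z - w) = cplx_shift A l z - cplx_shift A l w.
  rewrite /cplx_shift /= !op_funB//.
  by congr pair; apply: (ip_ext ipg) => v; rewrite !(ipE ipg); ring.
have inj z w : cplx_shift A l z = cplx_shift A l w -> z = w.
  move=> e; apply/subr0_eq; apply: (ip_norm_eq0 ip2); apply/eqP.
  rewrite eq_le (ip_norm_ge0 (g := cplx_ip)) andbT -(ler_pM2l nr) mulr0.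
  by rewrite (le_trans (low _))// shiftB e subrr (ip_norm0 ip2).
have surj w : exists z, cplx_shift A l z = w.
  (* [a'] and [b'] are the real and imaginary parts of [1 / l]. Multiplying [z - A z / l = - w / l]
     by [- l] gives [A z - l z = w]. *)
  pose a' := a / (a ^+ 2 + b ^+ 2); pose b' := - b / (a ^+ 2 + b ^+ 2).
  pose S z := cplx_scale a' b' (A2 z).
  have Slin : linear S.
    move=> c x y; rewrite /S /cplx_scale /A2 /= !op_linear//.
    by congr pair; apply: (ip_ext ipg) => v; rewrite !(ipE ipg); ring.
  pose SM := GRing.isLinear.Build _ _ _ _ _ Slin.
  pose SL : {linear _ -> _} := HB.pack S SM.
  have n' : Num.sqrt (a' ^+ 2 + b' ^+ 2) = n^-1.
    have -> : a' ^+ 2 + b' ^+ 2 = n^-1 ^+ 2.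
      by rewrite exprVn nn /a' /b'; field.
    by rewrite sqrtr_sqr gtr0_norm// invr_gt0.
  have Sq z : ip_norm cplx_ip (SL z) <= r / n * ip_norm cplx_ip z.
    rewrite -[SL z]/(S z) cplx_scale_norm n' mulrC mulrAC.
    by apply: ler_wpM2r => //; rewrite invr_ge0 ltW.
  have [||z hz] := neumann_solvable cplx_hilbert _ _ Sq (- cplx_scale a' b' w).
  - by rewrite divr_ge0// ltW.
  - by rewrite ltr_pdivrMr// mul1r.
  exists z; rewrite shiftE.
  have K v : cplx_scale a b (cplx_scale a' b' v) = v.
    case: v => v1 v2; rewrite /cplx_scale /=.
    by congr pair; apply: (ip_ext ipg) => v; rewrite !(ipE ipg) /a' /b'; field.
  have -> : cplx_scale a b z = cplx_scale a b (S z - cplx_scale a' b' w).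
    by rewrite -hz addrC subrK.
  have -> : cplx_scale a b (S z - cplx_scale a' b' w) = A2 z - w.
    rewrite -[w in RHS]K -[A2 z in RHS]K -/(S z).
    rewrite /cplx_scale /=.
    by congr pair; apply: (ip_ext ipg) => v; rewrite !(ipE ipg); ring.
  by rewrite opprB addrC subrK.
have [B KB] := choice surj.
exists B; split=> [z _|w|].
- by apply: inj; rewrite KB.
- by split; [split; exact: domA | exact: KB].
- exists (n - r)^-1 => w; rewrite ler_pdivlMl//.
  by have := low (B w); rewrite KB.
Qed.

End BoundedOperators.

(** * Finite speed and everywhere defined operators *)

Section SpeedBounds.
Context {R : realType} {H : lmodType R} {g : H -> H -> R}.
Hypothesis hilb : hilbert_space g.
Let ipg : inner_product g := proj1 hilb.
Context {d : nat}.
Implicit Type A : 'I_d -> operator H.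

Lemma ip_suml (I : finType) (f : I -> H) y :
  g (\sum_i f i) y = \sum_i g (f i) y.
Proof.
by apply: (big_morph (fun x => g x y)) => [x z|]; rewrite ?(ipDl ipg)// (ip0l ipg).
Qed.

Lemma self_adjoint_symmetric (B : operator H) : self_adjoint g B ->
  symmetric_op (g := g) B.
Proof.
by move=> [_ sB] x y dx dy; exact: (sB y (B y)).1.
Qed.

Lemma op_comb_symmetric A (s : 'rV[R]_d) :
  (forall j, self_adjoint g (A j)) -> symmetric_op (g := g) (op_comb s A).
Proof.
move=> sA x y dx dy; rewrite /= ip_suml (ipC ipg) ip_suml.
apply: eq_bigr => j _; rewrite !(ipZl ipg) (ipC ipg _ x); congr (_ * _).
exact: (self_adjoint_symmetric (sA j)).
Qed.

Lemma spectral_radius_max_speed A s : sphere s ->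
  (spectral_radius g (op_comb s A) <= max_speed g A)%E.
Proof. by move=> hs; apply: ereal_sup_ubound; exists s. Qed.

(** The 0 adjoined in [spectral_radius] excludes [-oo] and gives [0 <= r]. *)
Lemma spectral_radius_finite (B : operator H) : (spectral_radius g B < +oo)%E ->
  exists2 r, 0 <= r & spectral_radius g B = r%:E.
Proof.
have h0 : (0 <= spectral_radius g B)%E by apply: ereal_sup_ubound; left.
case: (spectral_radius g B) h0 => [r| |] // r0 _.
by exists r; rewrite -?lee_fin.
Qed.

(* (B - t)^-1 is close to -1/t for large t, hence onto, while its range is the
   domain of B. *)
Lemma bounded_symmetric_total (B : operator H) r : 0 <= r ->
  (spectral_radius g B <= r%:E)%E -> symmetric_op (g := g) B ->
  (forall x, op_dom B x -> ip_norm g (B x) <= r * ip_norm g x) ->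
  forall x, op_dom B x.
Proof.
move=> r0 Br Bsym Bb x.
(* With this [t] the contraction factor [r / (t - r)] is [r / (r + 1)]. *)
pose t := r + r + 1.
have t0 : 0 < t by rewrite /t; lra.
have rt : r < `|t| by rewrite gtr0_norm// /t; lra.
have [T [TB BT _]] := real_resolvent ipg Br rt.
have Tw w : (`|t| - r) * ip_norm g (T w) <= ip_norm g w.
  have [dx ex] := BT w; rewrite -{2}ex.
  exact: (symmetric_shift_lower_bound ipg).
(* [S] is [B \o T], while [w - S w] is a multiple of [T w] and hence in the domain of [B]. *)
pose S w := w + t *: T w.
have Slin : linear S.
  move=> a u v; rewrite /S linearD linearZ /=.
  by apply: (ip_ext ipg) => z; rewrite !(ipE ipg); ring.
pose SM := GRing.isLinear.Build _ _ _ _ _ Slin.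
pose SL : {linear _ -> _} := HB.pack S SM.
have Sq w : ip_norm g (SL w) <= r / (r + 1) * ip_norm g w.
  have [dx ex] := BT w.
  have -> : SL w = B (T w) by rewrite -[SL w]/(w + t *: T w) -{1}ex subrK.
  apply: (le_trans (Bb _ dx)); rewrite -mulrA ler_wpM2l//.
  rewrite ler_pdivlMl; last by lra.
  apply: le_trans (Tw w); rewrite gtr0_norm// /t; lra.
have [||w hw] := neumann_solvable hilb _ _ Sq x.
- by rewrite divr_ge0// addr_ge0.
- by rewrite ltr_pdivrMr ?mul1r; lra.
rewrite -hw -[SL w]/(w + t *: T w) opprD addrA subrr add0r -scaleNr.
by apply: op_domZ; have [] := BT w.
Qed.

End SpeedBounds.

(** Finite speed makes [B - t] onto for large real [t], which prevents [B] from being a proper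
    restriction of [A ord0]. Hence [B] is densely defined, so bounded, so everywhere defined. *)
Lemma self_adjoint_total (R : realType) (H : lmodType R) (g : H -> H -> R)
    (d : nat) (A : 'I_d -> operator H) : (0 < d)%N -> hilbert_space g ->
  (forall j, self_adjoint g (A j)) -> (max_speed g A < +oo)%E ->
  forall j x, op_dom (A j) x.
Proof.
case: d A => // d A _ hilb sA Afin.
have ipg := proj1 hilb.
(* In this direction [B] acts as [A ord0], but its domain is the intersection of all the domains, so
   a total [B] settles every [j]. *)
pose s : 'rV[R]_d.+1 := delta_mx 0 0.
have hs : sphere s.
  rewrite /sphere /= (bigD1 ord0)//= big1 => [|j j0].
    by rewrite mxE !eqxx expr1n addr0.
  by rewrite mxE (negbTE j0) andbF expr0n.
have [r r0 rE] := spectral_radius_finite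
  (le_lt_trans (spectral_radius_max_speed A hs) Afin).
set B := op_comb s A in rE.
have Br : (spectral_radius g B <= r%:E)%E by rewrite rE.
have Bsym : symmetric_op (g := g) B by exact: op_comb_symmetric.
have BE x : B x = A ord0 x.
  rewrite /= (bigD1 ord0)//= big1 => [|j j0]; last first.
    by rewrite mxE (negbTE j0) andbF scale0r.
  by rewrite mxE !eqxx scale1r addr0.
have r1 : r < `|r + 1| by rewrite gtr0_norm; lra.
(* With [t = r + 1], let [z] solve [(B - t) z = (A ord0 - t) x]. Then [x - z] is in the kernel of
   [A ord0 - t], thus orthogonal to the range of [B - t], which is all of [H]. *)
have dom0 x : op_dom (A ord0) x -> op_dom B x.
  move=> dx; have [T [_ BT _]] := real_resolvent ipg Br r1.
  pose z := T (A ord0 x - (r + 1) *: x).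
  have [dz ez] := BT (A ord0 x - (r + 1) *: x).
  suff -> : x = z by [].
  have dz0 : op_dom (A ord0) z by exact: dz.
  apply/subr0_eq/eqP; rewrite -[_ == _]negbK -(ip_gt0 ipg).
  set y := x - z.
  have dy : op_dom (A ord0) y by exact: op_domB.
  have ey : A ord0 y = (r + 1) *: y.
    rewrite /y op_funB// scalerBr; apply/subr0_eq.
    move: ez; rewrite -/z BE => /eqP; rewrite -subr_eq0 => /eqP e.
    rewrite -oppr0 -e; apply: (ip_ext ipg) => v; rewrite !(ipE ipg); ring.
  clearbody y; have [dw ew] := BT y.
  have := self_adjoint_symmetric (sA ord0) (dw ord0) dy.
  rewrite -(BE (T y)) ey => h.
  by rewrite -{1}ew !(ipE ipg) h !(ipE ipg) subrr ltxx.
have Bdense x e : 0 < e -> exists2 z, op_dom B z & ip_norm g (x - z) < e.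
  move=> e0; have [z dz xz] := (sA ord0).1 x e e0.
  by exists z => //; exact: dom0.
have Bb := symmetric_bound ipg r0 Bsym Bdense
  (symmetric_numerical_range ipg r0 Br Bsym).
move=> j x; exact: (bounded_symmetric_total hilb r0 Br Bsym Bb x).
Qed.

(** * Compression of operators by an isometry and its adjoint *)

Section Compression.
Context {R : realType} {H K : lmodType R} {g : H -> H -> R} {h : K -> K -> R}.
Context {P : {linear H -> K}} {J : {linear K -> H}}.
Hypothesis hilb : hilbert_space g.
Hypothesis PJ : forall y, P (J y) = y.
Hypothesis hE : forall x y, h x y = g (J x) (J y).
Hypothesis PJadj : forall x y, h (P x) y = g x (J y).
Let ipg : inner_product g := proj1 hilb.

(** [J] is an isometry and takes Cauchy sequences to Cauchy sequences of [H]; the contraction [P]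
    brings the limit back. *)
Lemma compression_hilbert : hilbert_space h.
Proof.
have nE y : ip_norm h y = ip_norm g (J y) by rewrite /ip_norm hE.
have iph : inner_product h.
  split=> [x y|a x y z|x x0].
  - by rewrite !hE (ipC ipg).
  - by rewrite !hE linearD linearZ /= !(ipE ipg).
  - rewrite hE (ip_gt0 ipg); apply: contra x0 => /eqP Jx.
    by rewrite -[x]PJ Jx linear0.
split=> // s cs.
(* Divide [|P x|^2 = <x, J (P x)> <= |x| |P x|] by [|P x|]. *)
have nP x : ip_norm h (P x) <= ip_norm g x.
  have [->|n0] := eqVneq (ip_norm h (P x)) 0; first exact: ip_norm_ge0.
  have np : 0 < ip_norm h (P x) by rewrite lt_neqAle eq_sym n0 ip_norm_ge0.
  rewrite -(ler_pM2r np) -expr2 (ip_norm_sqr iph) PJadj nE.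
  exact: le_trans (ler_norm _) (ip_abs_le ipg _ _).
have [|l hl] := hilb.2 (fun n => J (s n)).
  move=> e /cs[N hN]; exists N => m n Nm Nn.
  by rewrite -linearB -nE; exact: hN.
exists (P l) => e /hl[N hN]; exists N => n /hN.
by apply: le_lt_trans; rewrite -{1}(PJ (s n)) -linearB.
Qed.

(** The bound is proved for each direction [s] separately: adjointness gives
    [<P B J y, y> = <B J y, J y>] and [|J y| = |y|], so the bound [r] on the quadratic form of [B]
    survives. *)
Lemma compression_max_speed (d : nat) (A : 'I_d -> operator H) : (0 < d)%N ->
  (forall j, self_adjoint g (A j)) -> (max_speed g A < +oo)%E ->
  (max_speed h (fun j => op_sandwich P (A j) J) <= max_speed g A)%E.
Proof.
move=> d0 sA Afin.
have dA := self_adjoint_total d0 hilb sA Afin.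
have hilbh := compression_hilbert; have iph := proj1 hilbh.
apply: ub_ereal_sup => _ [s hs <-].
have sle : (spectral_radius g (op_comb s A) <= max_speed g A)%E.
  exact: spectral_radius_max_speed.
apply: le_trans sle.
have [r r0 rE] := spectral_radius_finite (le_lt_trans
  (spectral_radius_max_speed A hs) Afin).
set B := op_comb s A in rE *.
have Br : (spectral_radius g B <= r%:E)%E by rewrite rE.
have Bsym : symmetric_op (g := g) B by exact: op_comb_symmetric.
have Bnum := symmetric_numerical_range ipg r0 Br Bsym.
have dB x : op_dom B x by move=> j; exact: dA.
set C := op_comb s _.
have CE y : C y = P (B (J y)).
  by rewrite /= linear_sum; apply: eq_bigr => j _; rewrite linearZ.
have dC y : op_dom C y by move=> j; exact: dA.
have Csym : symmetric_op (g := h) C.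
  by move=> x y _ _; rewrite CE PJadj Bsym// (ipC iph) CE PJadj (ipC ipg).
have Cb : forall y, op_dom C y -> ip_norm h (C y) <= r * ip_norm h y.
  apply: symmetric_bound => //.
    by move=> x e e0; exists x => //; rewrite subrr (ip_norm0 iph).
  by move=> y _; rewrite CE PJadj hE; exact: Bnum.
(* The first alternative is the 0 adjoined in [spectral_radius]. *)
rewrite rE; apply: ub_ereal_sup => _ [->|[l nl <-]]; first by rewrite lee_fin.
rewrite lee_fin leNgt; apply/negP => rl; apply: nl.
exact: (bounded_resolvent hilbh r0 dC (fun y => Cb y (dC y))).
Qed.

End Compression.

Theorem theorem4 (R : realType) (d : nat) (d_gt0 : (0 < d)%N)
  (E : completeNormedModType R) (M : manifold E) (g : metric M)
  (g_riemannian : riemannian_metric g)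
  (g_hilbert : forall u : M, hilbert_space (@g u))
  (A : forall u : M, 'I_d -> operator (tangent u))
  (A_self_adjoint : forall (u : M) (j : 'I_d), self_adjoint (@g u) (A u j))
  (A_finite : forall u : M, (max_speed (@g u) (A u) < +oo)%E)
  (F : completeNormedModType R) (Mh : manifold F)
  (i : Mh -> M) (i_embedding : closed_embedding i)
  (p : M -> Mh) (p_smooth : smooth_map p) (pi_id : forall uh, p (i uh) = uh)
  (p_adjoint : forall (uh : Mh) (X : forall u : M, tangent u)
       (Yh : forall vh : Mh, tangent vh),
     smooth_field X -> smooth_field Yh ->
     pullback i g (u := uh) (tangent_map p (i uh) (X (i uh))) (Yh uh)
     = g (i uh) (X (i uh)) (tangent_map i uh (Yh uh))) :
  let gh := pullback i g in
  let Ah (uh : Mh) (j : 'I_d) : operator (tangent uh) :=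
    op_sandwich (K := tangent uh)
      (tangent_map p (i uh)) (A (i uh) j) (tangent_map i uh) in
  forall uh : Mh,
    (max_speed (@gh uh) (Ah uh) <= max_speed (@g (i uh)) (A (i uh)))%E /\
    (max_speed (@g (i uh)) (A (i uh)) < +oo)%E.
Proof.
move=> gh Ah uh; split; last exact: A_finite.
apply: (compression_max_speed (g_hilbert (i uh))) => //.
- case: i_embedding => si _ _ _ _ y.
  exact: (tangent_map_retraction si p_smooth pi_id).
- move=> x y.
  (* The hypothesis on [p] concerns smooth fields, so both vectors are first written as values of
     such fields. *)
  have [X sX <-] := smooth_field_extension x.
  have [Y sY <-] := smooth_field_extension y.
  exact: p_adjoint.
Qed.
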